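(* Let $N\ge2$ mobile robots with headings $\theta_i\in[0,2\pi)$ be connected in an all-to-all topology, with pairwise distinct initial headings, and run the rate-constrained pulse-coupled heading control described in the context with phase response function $$F(\phi)=\begin{cases}l_1\left(\frac{2\pi}{N}-\phi\right) & 0<\phi<\frac{2\pi}{N},\\ 0 & \frac{2\pi}{N}\le\phi\le 2\pi\frac{N-1}{N},\\ l_2\left(2\pi\frac{N-1}{N}-\phi\right) & 2\pi\frac{N-1}{N}<\phi<2\pi,\end{cases}$$ where $l_1,l_2\in[0,1)$ are not both zero. Then the headings desynchronize: the differences between cyclically consecutive headings all converge to $\frac{2\pi}{N}$, while $|\dot\theta_i|\le\omega_{\max}$ holds at all times.
   Context: Rate-constrained pulse-coupled heading control: each robot $i$ has a heading $\theta_i\in[0,2\pi)$ and an auxiliary phase $\phi_i\in[0,2\pi)$ with $\phi_i(0)=\theta_i(0)$. Fix a fundamental frequency $\omega_0>0$ and a maximum rotation rate $\omega_{\max}>0$, common to all robots. The phase evolves as $\dot\phi_i=\omega_i$, normally $\omega_i=\omega_0$. When $\phi_i$ reaches $2\pi$, robot $i$ fires a pulse received instantly by all other robots, resets $\phi_i$ to $0$, and resets $\omega_i$ to $\omega_0$ (abandoning any unfinished adjustment). When robot $i$ receives a pulse, it computes $\psi_i=F(\phi_i)$ from its current phase, sets $\omega_i=\omega_0+\omega_{\max}$ if $\psi_i>0$, $\omega_i=\omega_0-\omega_{\max}$ if $\psi_i<0$, or $\omega_i=\omega_0$ if $\psi_i=0$, keeps it for duration $\tau_i=|\psi_i|/\omega_{\max}$,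 then returns to $\omega_0$; if a new pulse is received before $\tau_i$ elapses, the adjustment is recomputed from the current phase. The heading obeys $\dot\theta_i=\dot\phi_i-\omega_0$, so $\theta_i=(\phi_i-\omega_0t)\bmod 2\pi$. Desynchronization: ordering the robots so that initially $0\le\phi_N<\dots<\phi_1<2\pi$, with $\Delta_i=(\phi_i-\phi_{i+1})\bmod 2\pi$ ($i<N$), $\Delta_N=(\phi_N-\phi_1)\bmod2\pi$, the measure $P=\sum_i|\Delta_i-\frac{2\pi}{N}|$ converges to $0$ (equivalently for the headings). *)

(* Defs.v *)
From Stdlib Require Import Reals Lra Lia List.
Open Scope R_scope.

(* Real remainder modulo 2*PI, with values in [0, 2*PI).
   [up x] is the unique integer with x < up x <= x + 1, so
   IZR (up x) - 1 is the floor of x. *)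
Definition rmod2pi (x : R) : R :=
  x - 2 * PI * (IZR (up (x / (2 * PI))) - 1).

Definition PRF (N : nat) (l1 l2 : R) (phi : R) : R :=
  if Rlt_dec 0 phi then
    if Rlt_dec phi (2 * PI / INR N) then l1 * (2 * PI / INR N - phi)
    else if Rlt_dec (2 * PI * (INR N - 1) / INR N) phi then
      if Rlt_dec phi (2 * PI) then l2 * (2 * PI * (INR N - 1) / INR N - phi)
      else 0
    else 0
  else 0.

(* State of the network between events.
   ph i  : phase phi_i in [0, 2 PI)
   dir i : current adjustment direction in {-1,0,1}; omega_i = w0 + dir i * wmax
   rem i : remaining duration of the current adjustment (meaningful if dir i <> 0) *)
Record state := mkState { ph : nat -> R; dir : nat -> R; rem : nat -> R }.

Section Dyn.
Variables (N : nat) (w0 wmax l1 l2 : R).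

Definition rate (s : state) (i : nat) : R := w0 + dir s i * wmax.

Definition fire_time (s : state) (i : nat) : option R :=
  if Rlt_dec 0 (rate s i) then Some ((2 * PI - ph s i) / rate s i) else None.

Definition end_time (s : state) (i : nat) : option R :=
  if Req_EM_T (dir s i) 0 then None else Some (rem s i).

Definition omin (a b : option R) : option R :=
  match a, b with
  | Some x, Some y => Some (Rmin x y)
  | Some x, None => Some x
  | None, y => y
  end.

Definition next_dt (s : state) : R :=
  match fold_right (fun i acc => omin (omin (fire_time s i) (end_time s i)) acc)
          None (seq 0 N) with
  | Some x => x
  | None => 0
  end.

Definition is_some_eq (o : option R) (x : R) : bool :=
  match o with
  | Some y => if Req_EM_T y x then true else false
  | None => false
  end.

Definition fires (s : state) (i : nat) : bool := is_some_eq (fire_time s i) (next_dt s).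

Definition any_fires (s : state) : bool := existsb (fires s) (seq 0 N).

Definition sgn (x : R) : R :=
  if Rlt_dec 0 x then 1 else if Rlt_dec x 0 then -1 else 0.

Definition step (s : state) : state :=
  let dt := next_dt s in
  let p' i := ph s i + rate s i * dt in
  mkState
    (fun i => if fires s i then 0 else p' i)
    (fun i => if fires s i then 0
              else if any_fires s then sgn (PRF N l1 l2 (p' i))
              else if is_some_eq (end_time s i) dt then 0
              else dir s i)
    (fun i => if fires s i then 0
              else if any_fires s then Rabs (PRF N l1 l2 (p' i)) / wmax
              else if is_some_eq (end_time s i) dt then 0
              else if Req_EM_T (dir s i) 0 then 0
              else rem s i - dt).

Definition init_state (th0 : nat -> R) : state :=
  mkState th0 (fun _ => 0) (fun _ => 0).

Fixpoint traj (th0 : nat -> R) (k : nat) : state :=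
  match k with
  | O => init_state th0
  | S k' => step (traj th0 k')
  end.

Fixpoint ev_time (th0 : nat -> R) (k : nat) : R :=
  match k with
  | O => 0
  | S k' => ev_time th0 k' + next_dt (traj th0 k')
  end.

(* heading theta_i = (phi_i - w0 t) mod 2 PI at time ev_time k + s,
   for 0 <= s < next_dt (traj th0 k) *)
Definition heading (th0 : nat -> R) (k : nat) (s : R) (i : nat) : R :=
  rmod2pi (ph (traj th0 k) i + rate (traj th0 k) i * s - w0 * (ev_time th0 k + s)).

End Dyn.

(* j is the cyclic successor of i in the initial ordering of headings:
   the robot immediately behind i, i.e. minimizing (th0 i - th0 k) mod 2 PI
   over k <> i. *)
Definition cyc_next (N : nat) (th0 : nat -> R) (i j : nat) : Prop :=
  (j < N)%nat /\ j <> i /\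
  forall k, (k < N)%nat -> k <> i -> rmod2pi (th0 i - th0 j) <= rmod2pi (th0 i - th0 k).

(* Main.v *)
Require Import Defs.
From Stdlib Require Import Reals Lra Lia List Permutation Sorted Wf_nat.
Open Scope R_scope.

(** Let [a = 2 pi / N]. Between two pulses the robots keep their cyclic order, so everything
    is encoded in the [N] gaps seen at the pulses. A gap below [a] stays below [a], a gap of
    at least [a] never grows, and the gaps add up to [N a]; hence some gap is at least [a]
    forever, and it suffices to show that every other gap has limit inferior at least [a].
    This propagates backwards around the circle, starting from the robot just behind the gap
    that is always large.

    If [l1 > 0]: that robot is only pushed forward, by amounts that shorten the large gap,
    so its forward pushes tend to 0. When the forward pushes of a robot tend to 0, the gap
    behind it must have limit inferior at least [a] (otherwise it would be pushed again and
    again), and then the forward pushes of the next robot behind tend to 0 as well.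

    If [l1 = 0]: the robot behind the large gap is never pushed at all. Along the chain the
    deficits [max (0, a - gap)] decay, up to an arbitrarily small loss in the rate, like
    [(1 - l2)^q] after [q] rounds. The rate is needed to exclude collisions: when two robots
    get close, the front one fires shortly before the rear one, the adjustment is cut off,
    and the push is only proportional to the gap. *)

(** * Truncated adjustments and scalar recursions *)

(** An adjustment asking for a total displacement [u] has achieved [clamp u (w * t)] after time [t],
    since the rate bound allows at most [h = w * t] in either direction. *)
Definition clamp (u h : R) : R := Rmax (- h) (Rmin u h).

Ltac clamp_cases :=
  unfold clamp, Rmax, Rmin in *;
  repeat match goal with
  | |- context [Rle_dec ?x ?y] => destruct (Rle_dec x y)
  | H : context [Rle_dec ?x ?y] |- _ => destruct (Rle_dec x y)
  end.

Lemma clamp_0 h : 0 <= h -> clamp 0 h = 0.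
Proof. intros; clamp_cases; lra. Qed.

Lemma clamp_pos u h : 0 <= h -> 0 <= u -> 0 <= clamp u h <= u.
Proof. intros; clamp_cases; lra. Qed.

Lemma clamp_neg u h : 0 <= h -> u <= 0 -> u <= clamp u h <= 0.
Proof. intros; clamp_cases; lra. Qed.

Lemma clamp_bound u h : 0 <= h -> - h <= clamp u h <= h.
Proof. intros; clamp_cases; lra. Qed.

Lemma clamp_mono u v h : u <= v -> clamp u h <= clamp v h.
Proof. intros; clamp_cases; lra. Qed.

Lemma clamp_lip u v h d : 0 <= d -> u - v <= d -> clamp u h - clamp v h <= d.
Proof. intros; clamp_cases; lra. Qed.

(** Truncating at a wider level separates two displacements further. As the level is proportional to
    time, a gap never strays further from its initial value between two pulses than at the second
    one; [travel_gap] uses this. *)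
Lemma clamp_diff_mono u v h H : 0 <= h <= H ->
  Rabs (clamp u h - clamp v h) <= Rabs (clamp u H - clamp v H).
Proof.
  intros HH. unfold Rabs; destruct (Rcase_abs (clamp u h - clamp v h));
  destruct (Rcase_abs (clamp u H - clamp v H)); clamp_cases; lra.
Qed.

Lemma eventually_forall_lt (P : nat -> nat -> Prop) (M : nat) :
  (forall n, (n < M)%nat -> exists K, forall k, (K <= k)%nat -> P n k) ->
  exists K, forall k, (K <= k)%nat -> forall n, (n < M)%nat -> P n k.
Proof.
  induction M as [|M IH]; intros H.
  - exists 0%nat; intros; lia.
  - destruct IH as [K1 H1]; [intros n Hn; apply H; lia|].
    destruct (H M) as [K2 H2]; [lia|].
    exists (Nat.max K1 K2); intros k Hk n Hn.
    destruct (Nat.eq_dec n M) as [->|]; [apply H2|apply H1]; lia.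
Qed.

Lemma pow_eventually_small (C r e : R) : 0 <= r < 1 -> 0 < e ->
  exists K, forall q, (K <= q)%nat -> C * r ^ q <= e.
Proof.
  intros Hr He.
  destruct (Rle_dec C 0) as [HC|HC].
  - exists 0%nat; intros q _. pose proof (pow_le r q (proj1 Hr)). nra.
  - destruct (pow_lt_1_zero r ltac:(rewrite Rabs_pos_eq; lra) (e / C)) as [K HK].
    + apply Rdiv_lt_0_compat; lra.
    + exists K; intros q Hq. specialize (HK q Hq).
      rewrite Rabs_pos_eq in HK by (apply pow_le; lra).
      apply Rmult_lt_compat_l with (r := C) in HK; [|lra].
      replace (C * (e / C)) with e in HK by (field; lra). lra.
Qed.

Lemma linear_recursion_decay (e f : nat -> R) (t r C1 : R) (K : nat) :
  0 <= t -> t < r -> 0 <= C1 ->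
  (forall q, (K <= q)%nat -> f q <= C1 * r ^ q) ->
  (forall q, (K <= q)%nat -> e (S q) <= t * Rmax 0 (e q) + f q) ->
  exists C, 0 <= C /\ forall q, (K <= q)%nat -> e q <= C * r ^ q.
Proof.
  intros Ht Htr HC1 Hf He.
  assert (Hr : forall q, 0 < r ^ q) by (intros; apply pow_lt; lra).
  (* The first term makes [t * C + C1 <= r * C], which closes the induction; the second covers the
     start [q = K]. *)
  set (C := Rmax (C1 / (r - t)) (Rmax 0 (e K) / r ^ K)).
  assert (HCa : C1 <= C * (r - t)).
  { apply Rmult_le_reg_r with (/ (r - t)); [apply Rinv_0_lt_compat; lra|].
    rewrite Rmult_assoc, Rinv_r, Rmult_1_r by lra. apply Rmax_l. }
  assert (HCb : Rmax 0 (e K) <= C * r ^ K).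
  { apply Rmult_le_reg_r with (/ r ^ K); [apply Rinv_0_lt_compat; auto|].
    rewrite Rmult_assoc, Rinv_r, Rmult_1_r by (specialize (Hr K); lra). apply Rmax_r. }
  assert (HC : 0 <= C) by nra.
  exists C; split; [exact HC|].
  intros q Hq. induction Hq as [|q Hq IH].
  - eapply Rle_trans; [apply Rmax_r|exact HCb].
  - specialize (He q Hq); specialize (Hf q Hq); specialize (Hr q).
    assert (Rmax 0 (e q) <= C * r ^ q) by (apply Rmax_lub; nra).
    simpl. nra.
Qed.

(* The gap [g] shrinks at most by the factor [s] or by the perturbation, and when it is
   small it expands by [1 + kappa]. A perturbation decaying faster than
   [(s (1 + kappa))^q] cannot keep up with a collapsing gap, so [g] stays away from 0. *)
Lemma gap_recursion (g h f : nat -> R) (a s kappa : R) (Q0 : nat) :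
  0 < a -> 0 < s < 1 -> 0 < kappa ->
  (forall q, 0 < g q) ->
  (forall q, (Q0 <= q)%nat -> g q <= h q) ->
  (forall q, (Q0 <= q)%nat -> g q + Rmin ((1 - s) * (a - g q)) (kappa * g q) <= h q) ->
  (forall q, (Q0 <= q)%nat -> s * h q <= g (S q)) ->
  (forall q, (Q0 <= q)%nat -> h q - (1 - s) * f q <= g (S q)) ->
  (forall r, s < r < 1 -> exists C, 0 <= C /\ forall q, f q <= C * r ^ q) ->
  forall r, s < r < 1 -> exists C, 0 <= C /\ forall q, a - g q <= C * r ^ q.
Proof.
  intros Ha Hs Hk Hg Hgh Hh Hgs Hgf Hf.
  (* [b] is the crossover of the two terms of the minimum: below it [kappa * g q] is the smaller
     one, so the gap gains the factor [1 + kappa]. *)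
  set (b := (1 - s) * a / (kappa + (1 - s))).
  assert (Hb : kappa * b = (1 - s) * (a - b)) by (unfold b; field; lra).
  assert (Hb0 : 0 < b) by (unfold b; apply Rdiv_lt_0_compat; nra).
  assert (Hhb : forall q, (Q0 <= q)%nat -> (1 + kappa) * Rmin (g q) b <= h q).
  { intros q Hq. specialize (Hgh q Hq). specialize (Hh q Hq). specialize (Hg q).
    unfold Rmin in *. destruct (Rle_dec (g q) b);
    destruct (Rle_dec ((1 - s) * (a - g q)) (kappa * g q)); nra. }
  assert (Hlow : exists K, (Q0 <= K)%nat /\ exists gam, 0 < gam /\
            forall q, (K <= q)%nat -> gam <= g q).
  (* [r0] lies strictly between [s] and [Rmin 1 (s * (1 + kappa))], so the perturbation can be
     bounded by a geometric sequence that decays faster than a collapsing gap can. *)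
  { set (r0 := (s + Rmin 1 (s * (1 + kappa))) / 2).
    assert (Hr0 : s < r0 < 1 /\ r0 < s * (1 + kappa)).
    { assert (s < s * (1 + kappa)) by nra.
      unfold r0, Rmin; destruct (Rle_dec 1 (s * (1 + kappa))); lra. }
    destruct (Hf r0 (proj1 Hr0)) as [C0 [HC0 HfC]].
    (* [M * r0 ^ q] is the level at which the expansion pays for the perturbation. *)
    set (M := (1 - s) * C0 / kappa).
    assert (HM : kappa * M = (1 - s) * C0) by (unfold M; field; lra).
    assert (HM0 : 0 <= M) by (apply Rmult_le_reg_l with kappa; nra).
    destruct (pow_eventually_small M r0 b) as [K1 HK1]; [lra|lra|].
    set (K := Nat.max Q0 K1).
    assert (Hr0p : forall q, 0 < r0 ^ q) by (intros; apply pow_lt; lra).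
    (* A gap staying below [M * r0 ^ q] forever would be multiplied each round by at least
       [s * (1 + kappa) > r0], and would overtake that bound. *)
    assert (HK0 : exists K0, (K <= K0)%nat /\ M * r0 ^ K0 <= g K0).
    { apply Classical_Prop.NNPP. intros Hno.
      assert (Hlt : forall q, (K <= q)%nat -> g q < M * r0 ^ q).
      { intros q Hq. apply Rnot_le_lt. intros Hc. apply Hno. exists q; auto. }
      assert (Hgrow : forall i, (s * (1 + kappa)) ^ i * g K <= g (K + i)%nat).
      { induction i as [|i IH].
        - rewrite Nat.add_0_r. simpl. lra.
        - rewrite Nat.add_succ_r. simpl.
          assert (Hq : (Q0 <= K + i)%nat) by lia.
          specialize (Hgs _ Hq). specialize (Hhb _ Hq).
          specialize (Hlt (K + i)%nat ltac:(lia)). specialize (HK1 (K + i)%nat ltac:(lia)).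
          rewrite Rmin_left in Hhb by lra. nra. }
      assert (Hrho : 1 < s * (1 + kappa) / r0).
      { apply Rmult_lt_reg_r with r0; [lra|]. unfold Rdiv.
        rewrite Rmult_assoc, Rinv_l by lra. lra. }
      destruct (Pow_x_infinity (s * (1 + kappa) / r0)
                  ltac:(rewrite Rabs_pos_eq; lra) (M * r0 ^ K / g K)) as [i Hi].
      specialize (Hi i (le_n i)).
      rewrite Rabs_pos_eq in Hi by (apply pow_le; lra).
      specialize (Hgrow i). specialize (Hlt (K + i)%nat ltac:(lia)).
      rewrite pow_add in Hlt.
      unfold Rdiv in Hi. rewrite Rpow_mult_distr, pow_inv in Hi.
      pose proof (Hr0p i) as Hri. pose proof (Hg K) as HgK.
      apply Rge_le in Hi.
      apply Rmult_le_compat_r with (r := r0 ^ i * g K) in Hi; [|nra].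
      replace (M * r0 ^ K * / g K * (r0 ^ i * g K)) with (M * (r0 ^ K * r0 ^ i)) in Hi
        by (field; lra).
      replace ((s * (1 + kappa)) ^ i * / r0 ^ i * (r0 ^ i * g K))
        with ((s * (1 + kappa)) ^ i * g K) in Hi by (field; lra).
      lra. }
    destruct HK0 as [K0 [HKK0 HgK0]].
    exists K0; split; [lia|].
    exists (Rmin (g K0) b); split; [apply Rmin_glb_lt; auto|].
    (* Once above [M * r0 ^ q], the expansion outweighs the perturbation, so [Rmin (g q) b] is not
       lost and both bounds persist. *)
    assert (Hinv : forall q, (K0 <= q)%nat ->
              Rmin (g K0) b <= g q /\ M * r0 ^ q <= g q).
    { intros q Hq. induction Hq as [|q Hq [IH1 IH2]].
      - split; [apply Rmin_l|exact HgK0].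
      - assert (Hq' : (Q0 <= q)%nat) by lia.
        specialize (Hgf q Hq'); specialize (Hhb q Hq'); specialize (HfC q).
        specialize (HK1 q ltac:(lia)). pose proof (Hr0p q) as Hrq.
        pose proof (Rmin_r (g K0) b).
        assert (Hm1 : M * r0 ^ q <= Rmin (g q) b) by (apply Rmin_glb; lra).
        assert (Hm2 : Rmin (g K0) b <= Rmin (g q) b) by (apply Rmin_glb; lra).
        assert (Hge : Rmin (g q) b <= g (S q)).
        { assert (kappa * (M * r0 ^ q) <= kappa * Rmin (g q) b)
            by (apply Rmult_le_compat_l; lra).
          assert (kappa * (M * r0 ^ q) = (1 - s) * (C0 * r0 ^ q))
            by (rewrite <- 2!Rmult_assoc, HM; reflexivity).
          assert ((1 - s) * f q <= (1 - s) * (C0 * r0 ^ q))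
            by (apply Rmult_le_compat_l; lra).
          lra. }
        split; [lra|]. simpl.
        assert (r0 * (M * r0 ^ q) <= 1 * (M * r0 ^ q))
          by (apply Rmult_le_compat_r; [apply Rmult_le_pos|]; lra).
        nra. }
    intros q Hq. apply Hinv, Hq. }
  destruct Hlow as [K [HQK [gam [Hgam HgK]]]].
  (* With [g] at least [gam], both terms of the minimum are at least [theta] times a nonnegative
     deficit. This gives a first geometric rate, possibly too slow. *)
  set (theta := Rmin (1 - s) (kappa * gam / a)).
  assert (Hth : 0 < theta <= 1 - s /\ theta * a <= kappa * gam).
  { assert (0 < kappa * gam / a) by (apply Rdiv_lt_0_compat; nra).
    assert (kappa * gam / a * a = kappa * gam) by (field; lra).
    unfold theta, Rmin; destruct (Rle_dec (1 - s) (kappa * gam / a)); nra. }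
  assert (Hrec : forall q, (K <= q)%nat ->
            a - g (S q) <= (1 - theta) * Rmax 0 (a - g q) + (1 - s) * f q).
  { intros q Hq. assert (Hq' : (Q0 <= q)%nat) by lia.
    specialize (Hgf q Hq'); specialize (Hgh q Hq'); specialize (Hh q Hq').
    specialize (HgK q Hq). pose proof (Hg q).
    unfold Rmax, Rmin in *; destruct (Rle_dec 0 (a - g q));
    destruct (Rle_dec ((1 - s) * (a - g q)) (kappa * g q)); nra. }
  set (r1 := (1 + (1 - theta)) / 2).
  assert (Hr1 : s < r1 < 1 /\ 1 - theta < r1) by (unfold r1; lra).
  destruct (Hf r1 (proj1 Hr1)) as [C1 [HC1 Hf1]].
  destruct (linear_recursion_decay (fun q => a - g q) (fun q => (1 - s) * f q)
              (1 - theta) r1 ((1 - s) * C1) K) as [C2 [HC2 He2]]; try nra.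
  { intros q _. rewrite Rmult_assoc. apply Rmult_le_compat_l; [lra|auto]. }
  { exact Hrec. }
  destruct (pow_eventually_small C2 r1 (kappa * gam / (1 - s))) as [K2 HK2];
    [lra|apply Rdiv_lt_0_compat; nra|].
  intros r Hr.
  destruct (Hf r Hr) as [C3 [HC3 Hf3]].
  (* Past [K3] the deficit is so small that the minimum is [(1 - s) * (a - g q)]. The contraction
     factor becomes [s], and every [r > s] is reached. *)
  set (K3 := Nat.max K K2).
  destruct (linear_recursion_decay (fun q => a - g q) (fun q => (1 - s) * f q)
              s r ((1 - s) * C3) K3) as [C4 [HC4 He4]]; try nra.
  { intros q _. rewrite Rmult_assoc. apply Rmult_le_compat_l; [lra|auto]. }
  { intros q Hq. assert (Hq' : (Q0 <= q)%nat) by lia.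
    assert (He : (1 - s) * (a - g q) <= kappa * gam).
    { specialize (He2 q ltac:(lia)). specialize (HK2 q ltac:(lia)). simpl in He2.
      assert (Hx : (1 - s) * (a - g q) <= (1 - s) * (kappa * gam / (1 - s)))
        by (apply Rmult_le_compat_l; lra).
      replace ((1 - s) * (kappa * gam / (1 - s))) with (kappa * gam) in Hx by (field; lra).
      exact Hx. }
    specialize (Hgf q Hq'); specialize (Hgh q Hq'); specialize (Hh q Hq').
    specialize (HgK q ltac:(lia)).
    unfold Rmax, Rmin in *; destruct (Rle_dec 0 (a - g q));
    destruct (Rle_dec ((1 - s) * (a - g q)) (kappa * g q)); nra. }
  assert (Hrp : forall q, 0 < r ^ q) by (intros; apply pow_lt; lra).
  (* The second term covers the finitely many rounds before [K3], where the deficit is below [a]. *)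
  exists (Rmax C4 (a / r ^ K3)).
  assert (HmC : 0 <= Rmax C4 (a / r ^ K3)) by (eapply Rle_trans; [exact HC4|apply Rmax_l]).
  split; [exact HmC|].
  intros q. destruct (Nat.le_gt_cases K3 q) as [Hq|Hq].
  - eapply Rle_trans; [apply He4, Hq|].
    apply Rmult_le_compat_r; [specialize (Hrp q); lra|apply Rmax_l].
  - assert (Hpow : r ^ K3 <= r ^ q).
    { replace K3 with (q + (K3 - q))%nat by lia. rewrite pow_add.
      pose proof (Hrp q). pose proof (pow_incr r 1 (K3 - q) ltac:(lra)) as Hp.
      rewrite pow1 in Hp. nra. }
    assert (a <= Rmax C4 (a / r ^ K3) * r ^ K3).
    { apply Rle_trans with (a / r ^ K3 * r ^ K3).
      - right; field. specialize (Hrp K3); lra.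
      - apply Rmult_le_compat_r; [specialize (Hrp K3); lra|apply Rmax_r]. }
    specialize (Hg q). nra.
Qed.

(** * Dynamics of the gaps *)

Section Slots.
Variable N : nat.
Hypothesis HN : (2 <= N)%nat.

Definition prev_slot (m : nat) : nat := match m with O => (N - 1)%nat | S m' => m' end.

(** This is [n - k] modulo [N], as a recursion on [k] so that no truncated [n - k] occurs. *)
Fixpoint slot (n k : nat) : nat :=
  match k with O => Nat.modulo n N | S k' => prev_slot (slot n k') end.

Lemma slot_lt n k : (slot n k < N)%nat.
Proof.
  induction k as [|k IH]; simpl; [apply Nat.mod_upper_bound; lia|].
  unfold prev_slot; destruct (slot n k); lia.
Qed.

Lemma slot_mod n k : slot (n mod N) k = slot n k.
Proof.
  induction k as [|k IH]; simpl; [apply Nat.Div0.mod_mod|now rewrite IH].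
Qed.

Lemma slot_period n q k : slot (n + q * N) k = slot n k.
Proof. rewrite <- slot_mod, Nat.Div0.mod_add, slot_mod. reflexivity. Qed.

Lemma slot_succ n k :
  slot (S n) k = if Nat.eq_dec (slot n k) (N - 1) then 0%nat else S (slot n k).
Proof.
  induction k as [|k IH].
  - simpl. pose proof (Nat.div_mod_eq n N) as Hd.
    pose proof (Nat.mod_upper_bound n N ltac:(lia)) as Hm.
    destruct (Nat.eq_dec (n mod N) (N - 1)) as [e|e]; symmetry.
    + apply Nat.mod_unique with (q := S (n / N)); [lia|rewrite Nat.mul_succ_r; lia].
    + apply Nat.mod_unique with (q := (n / N)%nat); lia.
  - cbn [slot]. rewrite IH. pose proof (slot_lt n k).
    destruct (slot n k) as [|m]; cbn [prev_slot];
    repeat destruct Nat.eq_dec; cbn [prev_slot]; lia.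
Qed.

Lemma slot_add k m : (m < N)%nat -> slot (k + m) k = m.
Proof.
  intros Hm. induction k as [|k IH].
  - apply Nat.mod_small, Hm.
  - change (prev_slot (slot (S (k + m)) k) = m). rewrite slot_succ, IH.
    destruct Nat.eq_dec; simpl; lia.
Qed.

Lemma slot_congr n k : ((k + slot n k) mod N = n mod N)%nat.
Proof.
  induction k as [|k IH]; simpl slot; [apply Nat.Div0.mod_mod|].
  rewrite <- IH. destruct (slot n k) as [|m]; simpl prev_slot.
  - replace (S k + (N - 1))%nat with (k + 0 + 1 * N)%nat by lia.
    apply Nat.Div0.mod_add.
  - f_equal. lia.
Qed.

Lemma slot_onto k m : (m < N)%nat -> exists n, (n < N)%nat /\ slot n k = m.
Proof.
  intros Hm. exists ((k + m) mod N)%nat; split.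
  - apply Nat.mod_upper_bound; lia.
  - rewrite slot_mod; apply slot_add, Hm.
Qed.

End Slots.

(** * Phases and gaps at successive pulses *)

Section Discrete.
(** [X k] lists the phases right after pulse [k] in decreasing order. The robot that just fired
    appears twice, at [L] in slot 0 and at 0 in slot [N]. [T k] is the time until the next pulse,
    [c k m] the displacement achieved meanwhile, and [X_step] moves each robot up by one slot. *)
Variables (N : nat) (a l1 l2 w0 w : R) (F : R -> R) (X : nat -> nat -> R) (T : nat -> R).
Hypothesis HN : (2 <= N)%nat.
Hypothesis Ha : 0 < a.
Hypothesis Hl1 : 0 <= l1 < 1.
Hypothesis Hl2 : 0 <= l2 < 1.
Hypothesis Hw0 : 0 < w0.
Hypothesis Hw : 0 < w.
Let L := INR N * a.
Hypothesis HF0 : F 0 = 0.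
Hypothesis HFL : F L = 0.
Hypothesis HF : forall x, 0 < x < L ->
  F x = l1 * Rmax 0 (a - x) - l2 * Rmax 0 (x - (L - a)).
Let c (k m : nat) := clamp (F (X k m)) (w * T k).
Hypothesis HT : forall k, 0 < T k.
Hypothesis X_front : forall k, X k 0 = L.
Hypothesis X_last : forall k, X k N = 0.
Hypothesis X_decr : forall k m, (m < N)%nat -> X k (S m) < X k m.
Hypothesis X_step : forall k m, (m < N)%nat ->
  X (S k) m = X k (S m) + w0 * T k + c k (S m).
Let D (k m : nat) := X k m - X k (S m).
Let nx := prev_slot N.
Let pos := slot N.

Lemma two_a_le : 2 * a <= L.
Proof.
  unfold L. apply Rmult_le_compat_r; [lra|].
  apply le_INR in HN. simpl in HN. lra.
Qed.

(** The two nonzero pieces of [F] are disjoint because [2 * a <= L], so their slopes do not add up.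
    The jump of [F] at 0 is upward, which is the favourable direction when [x = 0]. *)
Lemma F_lip x y : 0 <= x -> x < y < L -> F x - F y <= Rmax l1 l2 * (y - x).
Proof.
  intros Hx Hy. pose proof two_a_le.
  pose proof (Rmax_l l1 l2). pose proof (Rmax_r l1 l2).
  rewrite (HF y) by lra.
  assert (Hab : 0 <= Rmax 0 (a - x) - Rmax 0 (a - y) /\ 0 <= Rmax 0 (y - (L - a)) - Rmax 0 (x - (L - a)) /\
     (Rmax 0 (a - x) - Rmax 0 (a - y)) + (Rmax 0 (y - (L - a)) - Rmax 0 (x - (L - a))) <= y - x).
  { unfold Rmax; repeat destruct Rle_dec; lra. }
  assert (HFx : F x <= l1 * Rmax 0 (a - x) - l2 * Rmax 0 (x - (L - a))).
  { destruct (Rle_lt_or_eq_dec 0 x Hx) as [Hp|<-].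
    - rewrite HF by lra. lra.
    - rewrite HF0, (Rmax_left 0 (0 - (L - a))) by lra.
      pose proof (Rmax_l 0 (a - 0)). nra. }
  set (A := Rmax 0 (a - x)) in *. set (A' := Rmax 0 (a - y)) in *.
  set (B := Rmax 0 (y - (L - a))) in *. set (B' := Rmax 0 (x - (L - a))) in *.
  assert (l1 * (A - A') <= Rmax l1 l2 * (A - A')) by (apply Rmult_le_compat_r; lra).
  assert (l2 * (B - B') <= Rmax l1 l2 * (B - B')) by (apply Rmult_le_compat_r; lra).
  assert (Rmax l1 l2 * (A - A' + (B - B')) <= Rmax l1 l2 * (y - x))
    by (apply Rmult_le_compat_l; lra).
  lra.
Qed.

Lemma F_anti x y : 0 < x -> x <= y < L -> F y <= F x.
Proof.
  intros Hx Hy. rewrite 2!HF by lra.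
  assert (l1 * Rmax 0 (a - y) <= l1 * Rmax 0 (a - x))
    by (apply Rmult_le_compat_l; [lra|unfold Rmax; repeat destruct Rle_dec; lra]).
  assert (l2 * Rmax 0 (x - (L - a)) <= l2 * Rmax 0 (y - (L - a)))
    by (apply Rmult_le_compat_l; [lra|unfold Rmax; repeat destruct Rle_dec; lra]).
  lra.
Qed.

Lemma F_low x : 0 < x <= a -> F x = l1 * (a - x).
Proof.
  intros Hx. pose proof two_a_le.
  rewrite HF, (Rmax_right 0 (a - x)), (Rmax_left 0 (x - (L - a))) by lra. ring.
Qed.

Lemma F_high x : L - a <= x < L -> F x = - l2 * (x - (L - a)).
Proof.
  intros Hx. pose proof two_a_le.
  rewrite HF, (Rmax_left 0 (a - x)), (Rmax_right 0 (x - (L - a))) by lra. ring.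
Qed.

Lemma F_nonpos x : a <= x < L -> F x <= 0.
Proof.
  intros Hx. pose proof (F_low a ltac:(lra)). pose proof (F_anti a x Ha Hx). nra.
Qed.

Lemma F_nonneg x : 0 < x <= L - a -> 0 <= F x.
Proof.
  intros Hx. pose proof (F_high (L - a) ltac:(lra)).
  pose proof (F_anti x (L - a) ltac:(lra) ltac:(lra)). nra.
Qed.

Lemma reach_pos k : 0 <= w * T k.
Proof. specialize (HT k). nra. Qed.

(** The one-sided Lipschitz constant [Rmax l1 l2] is below 1 and survives truncation, so a rear
    robot never catches up with the one in front. *)
Lemma advance_mono h x y : 0 <= x -> x < y < L ->
  x + clamp (F x) h < y + clamp (F y) h.
Proof.
  intros Hx Hy. pose proof (F_lip x y Hx Hy).
  assert (Rmax l1 l2 < 1) by (apply Rmax_lub_lt; lra).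
  pose proof (Rmax_l l1 l2).
  assert (clamp (F x) h - clamp (F y) h <= Rmax l1 l2 * (y - x)).
  { apply clamp_lip; [nra|lra]. }
  nra.
Qed.

Lemma D_pos k m : (m < N)%nat -> 0 < D k m.
Proof. intros Hm. pose proof (X_decr k m Hm). unfold D. lra. Qed.

Lemma X_le_of_D k m i d : (m + i <= N)%nat ->
  (forall m', (m' < N)%nat -> (m <= m' < m + i)%nat -> d <= D k m') ->
  X k (m + i)%nat + INR i * d <= X k m.
Proof.
  induction i as [|i IH]; intros Hm HD.
  - rewrite Nat.add_0_r. simpl. lra.
  - rewrite S_INR, Nat.add_succ_r.
    specialize (IH ltac:(lia) ltac:(intros; apply HD; lia)).
    specialize (HD (m + i)%nat ltac:(lia) ltac:(lia)). unfold D in HD. lra.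
Qed.

Lemma X_anti k m m' : (m <= m' <= N)%nat -> X k m' <= X k m.
Proof.
  intros Hm. replace m' with (m + (m' - m))%nat by lia.
  pose proof (X_le_of_D k m (m' - m) 0 ltac:(lia)
    ltac:(intros; left; apply D_pos; lia)). lra.
Qed.

Lemma X_range k m : (0 < m < N)%nat -> 0 < X k m < L.
Proof.
  intros Hm. pose proof (X_last k). pose proof (X_front k).
  pose proof (X_anti k (S m) N ltac:(lia)). pose proof (X_decr k m ltac:(lia)).
  pose proof (X_anti k 1 m ltac:(lia)). pose proof (X_decr k 0 ltac:(lia)). lra.
Qed.

Lemma c_front k : c k 0 = 0.
Proof. unfold c. rewrite X_front, HFL. apply clamp_0, reach_pos. Qed.

Lemma c_last k : c k N = 0.
Proof. unfold c. rewrite X_last, HF0. apply clamp_0, reach_pos. Qed.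

Lemma X1_eq k : X k 1 = L - D k 0.
Proof. unfold D. rewrite X_front. lra. Qed.

Lemma X_pred_eq k : X k (N - 1)%nat = D k (N - 1)%nat.
Proof. unfold D. replace (S (N - 1)) with N by lia. rewrite X_last. lra. Qed.

(** Neither copy of the fired robot is pushed, so the formula also holds when slot 0 wraps around to
    slot [N - 1]. *)
Lemma D_step k m : (m < N)%nat -> D (S k) (nx m) = D k m + c k m - c k (S m).
Proof.
  intros Hm. unfold D, nx. destruct m as [|m]; simpl.
  - replace (S (N - 1)) with N by lia. rewrite c_front, X_last.
    rewrite X_step by lia. replace (S (N - 1)) with N by lia.
    rewrite c_last, X_last. pose proof (X_step k 0 ltac:(lia)) as H0.
    rewrite X_front in H0. rewrite X_front. lra.
  - rewrite 2!X_step by lia. lra.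
Qed.

Lemma c_mono_interior k m : (0 < m)%nat -> (S m < N)%nat -> c k m <= c k (S m).
Proof.
  intros H1 H2. apply clamp_mono.
  pose proof (X_range k m ltac:(lia)). pose proof (X_range k (S m) ltac:(lia)).
  pose proof (X_decr k m ltac:(lia)). apply F_anti; lra.
Qed.

(** [F] is nonincreasing, so the rear robot is pushed forward at least as much as the front one.
    Only the gaps next to the fired robot can grow. *)
Lemma D_interior k m : (0 < m)%nat -> (S m < N)%nat -> D (S k) (nx m) <= D k m.
Proof.
  intros H1 H2. rewrite D_step by lia. pose proof (c_mono_interior k m H1 H2). lra.
Qed.

Lemma c_first_low k : D k 0%nat <= a -> - l2 * (a - D k 0%nat) <= c k 1%nat <= 0.
Proof.
  intros HD. pose proof (D_pos k 0 ltac:(lia)).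
  assert (HF1 : F (X k 1%nat) = - l2 * (a - D k 0%nat)).
  { rewrite X1_eq, F_high by lra. ring. }
  unfold c. rewrite HF1. apply clamp_neg; [apply reach_pos|nra].
Qed.

(** A gap next to the fired robot grows by at most [l2] (slot 0) or [l1] (slot [N - 1]) times its
    deficit, and both factors are below 1. *)
Lemma small_persists k m : (m < N)%nat -> D k m < a -> D (S k) (nx m) < a.
Proof.
  intros Hm HD. rewrite D_step by lia.
  destruct m as [|m].
  - rewrite c_front. pose proof (c_first_low k ltac:(lra)).
    pose proof (D_pos k 0 Hm). nra.
  - destruct (Nat.eq_dec (S (S m)) N) as [e|e].
    + rewrite e, c_last. pose proof (D_pos k (S m) Hm) as Hp.
      assert (HX : X k (S m) = D k (S m)) by (unfold D; rewrite e, X_last; lra).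
      unfold c. rewrite HX, F_low by lra.
      pose proof (clamp_pos (l1 * (a - D k (S m))) (w * T k) (reach_pos k) ltac:(nra)).
      nra.
    + pose proof (c_mono_interior k (S m) ltac:(lia) ltac:(lia)). lra.
Qed.

(** A neighbour at distance at least [a] from the fired robot is pushed, if at all, towards it. *)
Lemma big_decreases k m : (m < N)%nat -> a <= D k m -> D (S k) (nx m) <= D k m.
Proof.
  intros Hm HD. destruct m as [|m].
  - rewrite D_step, c_front by lia.
    assert (0 <= c k 1%nat).
    { pose proof (X_range k 1 ltac:(lia)). apply clamp_pos; [apply reach_pos|].
      apply F_nonneg. rewrite X1_eq in *. lra. }
    lra.
  - destruct (Nat.eq_dec (S (S m)) N) as [e|e].
    + rewrite D_step, e, c_last by lia.
      assert (HX : X k (S m) = D k (S m)) by (unfold D; rewrite e, X_last; lra).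
      pose proof (X_range k (S m) ltac:(lia)).
      assert (c k (S m) <= 0).
      { apply clamp_neg; [apply reach_pos|]. apply F_nonpos. lra. }
      lra.
    + apply D_interior; lia.
Qed.

(* Index [n] names the gap between the robots firing at events [n] and [n + 1] modulo [N];
   [pos n k] is the place of that gap in the order seen just after event [k]. *)
Definition always_big (n : nat) : Prop := forall k, a <= D k (pos n k).
Definition eventually_big (n : nat) : Prop :=
  forall e, 0 < e -> exists K, forall k, (K <= k)%nat -> a - e <= D k (pos n k).
Definition pushes_vanish (n : nat) : Prop :=
  forall e, 0 < e -> exists K, forall k, (K <= k)%nat -> c k (pos n k) <= e.

Lemma pos_lt n k : (pos n k < N)%nat.
Proof. apply slot_lt; lia. Qed.

Lemma small_or_big n :
  always_big n \/ exists K, forall k, (K <= k)%nat -> D k (pos n k) < a.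
Proof.
  destruct (Classical_Prop.classic (always_big n)) as [H|H]; [now left|right].
  apply Classical_Pred_Type.not_all_ex_not in H. destruct H as [K HK].
  exists K. intros k Hk. induction Hk as [|k Hk IH]; [lra|].
  apply small_persists; [apply pos_lt|exact IH].
Qed.

Lemma exists_always_big : exists n, (n < N)%nat /\ always_big n.
Proof.
  apply Classical_Prop.NNPP. intros Hno.
  destruct (eventually_forall_lt (fun n k => D k (pos n k) < a) N) as [K HK].
  { intros n Hn. destruct (small_or_big n) as [H|H]; [|exact H].
    exfalso; apply Hno; exists n; auto. }
  assert (Hsum : forall i, (i < N)%nat -> L - INR (S i) * a < X K (S i)).
  { assert (HD : forall i, (i < N)%nat -> D K i < a).
    { intros i Hi. destruct (slot_onto N HN K i Hi) as [n [Hn <-]].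
      apply HK; [lia|exact Hn]. }
    induction i as [|i IH]; intros Hi.
    - specialize (HD 0%nat Hi). pose proof (X1_eq K). simpl. lra.
    - specialize (HD (S i) Hi). specialize (IH ltac:(lia)).
      rewrite S_INR. unfold D in HD. lra. }
  specialize (Hsum (N - 1)%nat ltac:(lia)).
  replace (S (N - 1)) with N in Hsum by lia. rewrite X_last in Hsum.
  unfold L in Hsum. lra.
Qed.

Lemma pos_next n k : pos n (S k) = nx (pos n k).
Proof. reflexivity. Qed.

Lemma pos_succ n k :
  pos (S n) k = if Nat.eq_dec (pos n k) (N - 1) then 0%nat else S (pos n k).
Proof. apply slot_succ; lia. Qed.

(** The rear robot of gap [n] is the front robot of gap [S n]; at the wrap from slot [N] to slot 0
    both pushes are 0. *)
Lemma c_pos_succ n k : c k (S (pos n k)) = c k (pos (S n) k).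
Proof.
  rewrite pos_succ. destruct Nat.eq_dec as [e|e]; [|reflexivity].
  rewrite e, c_front. replace (S (N - 1)) with N by lia. apply c_last.
Qed.

(** * Vanishing forward pushes and the case [l1 > 0] *)

Lemma always_big_decrements n : always_big n ->
  forall e, 0 < e -> exists K, forall k, (K <= k)%nat ->
    D k (pos n k) - D (S k) (pos n (S k)) <= e.
Proof.
  intros Hb e He. set (u k := D k (pos n k)).
  assert (Hdec : Un_decreasing u).
  { intros k. unfold u. rewrite pos_next. apply big_decreases; [apply pos_lt|apply Hb]. }
  assert (Hlb : has_lb u).
  { exists (- a). intros x [k ->]. unfold opp_seq. specialize (Hb k). unfold u. lra. }
  destruct (decreasing_cv u Hdec Hlb) as [l Hl].
  destruct (Hl (e / 2) ltac:(lra)) as [K HK].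
  exists K. intros k Hk.
  pose proof (HK k Hk) as H1. pose proof (HK (S k) ltac:(lia)) as H2.
  unfold R_dist, Rabs in H1, H2. fold (u k). fold (u (S k)).
  destruct (Rcase_abs (u k - l)); destruct (Rcase_abs (u (S k) - l)); lra.
Qed.

(* The front robot of a gap that is at least [a] and the rear one are never both pushed
   forward, so every forward push of the rear robot shortens that gap. *)
Lemma always_big_pushes_vanish n : always_big n -> pushes_vanish (S n).
Proof.
  intros Hb e He. destruct (always_big_decrements n Hb e He) as [K HK].
  exists K. intros k Hk. specialize (HK k Hk).
  rewrite <- c_pos_succ. rewrite pos_next, D_step in HK by apply pos_lt.
  assert (Hc : c k (pos n k) <= 0); [|lra].
  specialize (Hb k). pose proof (pos_lt n k) as Hp.
  destruct (pos n k) as [|m].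
  - rewrite c_front; lra.
  - apply clamp_neg; [apply reach_pos|]. apply F_nonpos.
    pose proof (X_range k (S m) ltac:(lia)).
    pose proof (X_anti k (S (S m)) N ltac:(lia)). rewrite X_last in *. unfold D in Hb. lra.
Qed.

(** Unless gap [n] is always big, it ends up between [a - e / 2] and [a]. Its front push minus its
    rear push is then at least [- e / 2], so a small front push leaves a small rear push. *)
Lemma pushes_vanish_succ n : eventually_big n -> pushes_vanish n -> pushes_vanish (S n).
Proof.
  intros HQ HR. destruct (small_or_big n) as [Hb|[K0 HK0]].
  - apply always_big_pushes_vanish, Hb.
  - intros e He. destruct (HQ (e / 2) ltac:(lra)) as [K1 HK1].
    destruct (HR (e / 2) ltac:(lra)) as [K2 HK2].
    exists (Nat.max K0 (Nat.max K1 K2)). intros k Hk.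
    specialize (HK0 k ltac:(lia)). specialize (HK1 (S k) ltac:(lia)).
    specialize (HK2 k ltac:(lia)).
    rewrite pos_next, D_step in HK1 by apply pos_lt.
    rewrite <- c_pos_succ. lra.
Qed.

(* In the [N] events after a robot [n + 1] fires with [n] at phase [x < a - e], robot [n]
   must itself fire; if all its pushes were tiny, the rate constraint would be active
   each time, hence the events very close together, and [n] could not have got that far. *)
Lemma gap_behind_firing n : 0 < l1 -> pushes_vanish n ->
  forall e, 0 < e -> exists K, forall k, (K <= k)%nat ->
    pos n k = (N - 1)%nat -> a - e <= D k (N - 1)%nat.
Proof.
  intros Hl HR e He.
  (* When the rate constraint is active, a push [w * T] comes with a drift [w0 * T], so the total
     advance is [v] times the push. *)
  set (v := 1 + w0 / w).
  assert (Hv : 1 < v) by (unfold v; pose proof (Rdiv_lt_0_compat w0 w Hw0 Hw); lra).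
  assert (HNp : 1 <= INR N) by (change 1 with (INR 1); apply le_INR; lia).
  (* The first bound forces a push of at most [eta] to be truncated while the phase is at most
     [a - e / 2]; the second keeps the advance over a whole round within [e / 2]. *)
  set (eta := Rmin (l1 * (e / 4)) (e / (2 * (INR N * v)))).
  assert (HNv : 0 < INR N * v) by nra.
  assert (Heta : 0 < eta /\ eta <= l1 * (e / 4) /\ INR N * v * eta <= e / 2).
  { assert (0 < e / (2 * (INR N * v))) by (apply Rdiv_lt_0_compat; lra).
    assert (0 < l1 * (e / 4)) by nra.
    unfold eta. split; [apply Rmin_glb_lt; lra|]. split; [apply Rmin_l|].
    apply Rle_trans with (INR N * v * (e / (2 * (INR N * v)))).
    - apply Rmult_le_compat_l; [lra|apply Rmin_r].
    - right; field; lra. }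
  destruct Heta as [Heta0 [Heta1 Heta2]].
  destruct (HR eta Heta0) as [K HK].
  exists K. intros k Hk Hpos. apply Rnot_lt_le. intros HD.
  rewrite <- X_pred_eq in HD.
  assert (Hi : forall i, (i <= N - 1)%nat ->
     pos n (k + i) = (N - 1 - i)%nat /\
     X (k + i)%nat (N - 1 - i)%nat <= X k (N - 1)%nat + INR i * (v * eta)).
  { induction i as [|i IH]; intros Hi.
    - rewrite Nat.add_0_r, Nat.sub_0_r. simpl. split; [exact Hpos|lra].
    - destruct (IH ltac:(lia)) as [IH1 IH2].
      rewrite Nat.add_succ_r, pos_next, IH1.
      replace (N - 1 - i)%nat with (S (N - 1 - S i)) in * by lia.
      split; [reflexivity|].
      rewrite X_step by lia. rewrite S_INR.
      specialize (HK (k + i)%nat ltac:(lia)). rewrite IH1 in HK.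
      pose proof (X_range (k + i) (S (N - 1 - S i)) ltac:(lia)) as Hx.
      set (x := X (k + i)%nat (S (N - 1 - S i))) in *.
      assert (Hxa : x <= a - e / 2).
      { assert (INR i * (v * eta) <= INR N * (v * eta))
          by (apply Rmult_le_compat_r; [nra|apply le_INR; lia]). lra. }
      assert (HFx : F x = l1 * (a - x)) by (apply F_low; lra).
      unfold c in HK |- *. fold x in HK |- *. rewrite HFx in *.
      assert (Hbig : l1 * (e / 2) <= l1 * (a - x)) by (apply Rmult_le_compat_l; lra).
      assert (Hpe : 0 < l1 * e) by nra.
      assert (HwT : w * T (k + i)%nat <= eta).
      { clear - HK Hbig Heta1 Hpe Heta0. clamp_cases; lra. }
      assert (HT' : w0 * T (k + i)%nat <= w0 / w * eta).
      { apply Rle_trans with (w0 / w * (w * T (k + i)%nat)).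
        - right; field; lra.
        - apply Rmult_le_compat_l; [|exact HwT].
          left; apply Rdiv_lt_0_compat; lra. }
      unfold v in *. lra. }
  (* After [N - 1] events the robot is in slot 0, at phase [L], although the bound keeps it below
     [a]. *)
  destruct (Hi (N - 1)%nat ltac:(lia)) as [_ Hend].
  rewrite Nat.sub_diag, X_front in Hend.
  assert (INR (N - 1) * (v * eta) <= INR N * (v * eta))
    by (apply Rmult_le_compat_r; [nra|apply le_INR; lia]).
  pose proof two_a_le. lra.
Qed.

(** [gap_behind_firing] settles slot [N - 1]. A deficit in slot 0 keeps at least the share [1 - l2]
    on moving to slot [N - 1], which settles slot 0. In between the gap does not grow on its way
    down to slot 0, so it was at least as large before. *)
Lemma pushes_vanish_big n : 0 < l1 -> pushes_vanish n -> eventually_big n.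
Proof.
  intros Hl HR e He.
  destruct (gap_behind_firing n Hl HR ((1 - l2) * e) ltac:(nra)) as [K HK].
  exists K. intros k Hk.
  assert (H0 : forall k', (K <= k')%nat -> pos n k' = 0%nat -> a - e <= D k' 0%nat).
  { intros k' Hk' Hp. apply Rnot_lt_le. intros HD.
    specialize (HK (S k') ltac:(lia)). rewrite pos_next, Hp in HK.
    specialize (HK eq_refl). change (N - 1)%nat with (nx 0) in HK.
    rewrite D_step, c_front in HK by lia.
    pose proof (c_first_low k' ltac:(lra)). nra. }
  pose proof (pos_lt n k) as Hp.
  destruct (Nat.eq_dec (pos n k) (N - 1)) as [e1|e1].
  - specialize (HK k Hk e1). rewrite e1. nra.
  - remember (pos n k) as m eqn:Hm.
    revert k Hk Hm Hp e1. induction m as [|m IH]; intros k Hk Hm Hp e1.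
    + apply H0; auto.
    + apply Rle_trans with (D (S k) m).
      * apply IH; try lia. rewrite pos_next, <- Hm. reflexivity.
      * apply (D_interior k (S m)); lia.
Qed.

Lemma all_big_forward n : 0 < l1 -> always_big n ->
  forall j, pushes_vanish (S n + j) /\ eventually_big (S n + j).
Proof.
  intros Hl Hb. induction j as [|j [IH1 IH2]].
  - rewrite Nat.add_0_r. assert (pushes_vanish (S n)) by now apply always_big_pushes_vanish.
    split; [assumption|now apply pushes_vanish_big].
  - rewrite Nat.add_succ_r. assert (pushes_vanish (S (S n + j))) by now apply pushes_vanish_succ.
    split; [assumption|now apply pushes_vanish_big].
Qed.

(** * Geometric decay of the deficits when [l1 = 0] *)

(** The gap is sampled at the pulses at which its front robot has just fired ([pos_fire]). The
    factor [1 - l2] is what an uninterrupted adjustment leaves of the deficit. *)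
Definition deficit_decays (n : nat) : Prop :=
  forall r, 1 - l2 < r < 1 ->
    exists C, 0 <= C /\ forall q, a - D (n + q * N) 0 <= C * r ^ q.

Lemma pos_fire n q : pos n (n + q * N) = 0%nat.
Proof.
  unfold pos. rewrite <- (slot_period N n q), <- (Nat.add_0_r (n + q * N)) at 1.
  apply slot_add; lia.
Qed.

Lemma pos_after_fire n q i : (i < N)%nat -> pos n (S (n + q * N + i)) = (N - 1 - i)%nat.
Proof.
  induction i as [|i IH]; intros Hi; rewrite pos_next.
  - rewrite Nat.add_0_r, pos_fire. simpl. lia.
  - rewrite Nat.add_succ_r, IH by lia. replace (N - 1 - i)%nat with (S (N - 1 - S i)) by lia.
    reflexivity.
Qed.

Lemma pos_pred n k m : pos (S n) k = S m -> pos n k = m.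
Proof. rewrite pos_succ. destruct Nat.eq_dec; lia. Qed.

Lemma c_nonpos k m : l1 = 0 -> (m <= N)%nat -> c k m <= 0.
Proof.
  intros Hl Hm. destruct (Nat.eq_dec m 0) as [->|H0]; [rewrite c_front; lra|].
  destruct (Nat.eq_dec m N) as [->|H1]; [rewrite c_last; lra|].
  apply clamp_neg; [apply reach_pos|].
  rewrite HF, Hl by (apply X_range; lia). pose proof (Rmax_l 0 (X k m - (L - a))). nra.
Qed.

Lemma c_zero k m : l1 = 0 -> (0 < m < N)%nat -> X k m <= L - a -> c k m = 0.
Proof.
  intros Hl Hm HX. unfold c. rewrite HF, Hl, (Rmax_left 0 (X k m - (L - a))) by
    (try apply X_range; lia || lra).
  rewrite Rmult_0_l, Rmult_0_r, Rminus_0_r. apply clamp_0, reach_pos.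
Qed.

(** The robot in slot 1 must cover [D k 0] before the next pulse and is never pushed forward, so
    [w0 * T k >= D k 0]. A truncated push therefore still amounts to [w / w0 * D k 0]. *)
Lemma back_push_lower k : l1 = 0 ->
  Rmin (l2 * (a - D k 0%nat)) (w / w0 * D k 0%nat) <= - c k 1%nat.
Proof.
  intros Hl. pose proof (c_nonpos k 1 Hl ltac:(lia)) as Hc.
  destruct (Rle_lt_dec a (D k 0%nat)) as [Hg|Hg].
  - eapply Rle_trans; [apply Rmin_l|]. nra.
  - pose proof (X_step k 0 ltac:(lia)) as Hs. rewrite X_front, X1_eq in Hs.
    assert (HwT : w / w0 * D k 0%nat <= w * T k).
    { replace (w * T k) with (w / w0 * (w0 * T k)) by (field; lra).
      apply Rmult_le_compat_l; [left; apply Rdiv_lt_0_compat; lra|lra]. }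
    pose proof (D_pos k 0 ltac:(lia)) as HD.
    unfold c. rewrite X1_eq, F_high by lra.
    replace (- l2 * (L - D k 0%nat - (L - a))) with (- (l2 * (a - D k 0%nat))) by ring.
    assert (0 <= l2 * (a - D k 0%nat)) by nra. pose proof (reach_pos k).
    clear Hc. clamp_cases; lra.
Qed.

Lemma back_push_upper k : l1 = 0 -> - (l2 * Rmax 0 (a - D k 0%nat)) <= c k 1%nat.
Proof.
  intros Hl. pose proof (c_first_low k) as Hc.
  unfold Rmax; destruct Rle_dec; [lra|].
  rewrite (c_zero k 1 Hl); [lra|lia|rewrite X1_eq; lra].
Qed.

(** One round of gap [S n]: just after its front robot fires, the gap grows to [h q]. By the phase
    hypothesis the front robot is not pushed in slots 2 and beyond, so the gap does not shrink
    there. In slot 1 the front robot is pushed back by at most [l2] times the deficit of gap [n].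
    This is [gap_recursion] with [s = 1 - l2] and [kappa = w / w0]. *)
Lemma deficit_decays_succ n : l1 = 0 -> 0 < l2 ->
  (exists K, forall k, (K <= k)%nat -> forall m, (2 <= m)%nat -> pos (S n) k = m ->
     X k m <= L - a) ->
  deficit_decays n -> deficit_decays (S n).
Proof.
  intros Hl H2 [K HK] Hn.
  set (h q := D (S n + q * N) 0%nat - c (S n + q * N) 1%nat).
  assert (Hmid : forall q, (K <= q)%nat -> forall i, (i <= N - 2)%nat ->
            h q <= D (S (S n + q * N + i)) (N - 1 - i)%nat).
  { intros q Hq. induction i as [|i IH]; intros Hi.
    - rewrite Nat.add_0_r, Nat.sub_0_r. change (N - 1)%nat with (nx 0).
      rewrite D_step, c_front by lia. unfold h. lra.
    - specialize (IH ltac:(lia)).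
      replace (N - 1 - S i)%nat with (nx (N - 1 - i))
        by (replace (N - 1 - i)%nat with (S (N - 1 - S i)) by lia; reflexivity).
      rewrite Nat.add_succ_r, D_step by lia.
      pose proof (pos_after_fire (S n) q i ltac:(lia)) as Hp.
      rewrite (c_zero (S (S n + q * N + i)) (N - 1 - i) Hl); [|lia|].
      + pose proof (c_nonpos (S (S n + q * N + i)) (S (N - 1 - i)) Hl ltac:(lia)). lra.
      + apply HK; [nia|lia|exact Hp]. }
  (* The factor comes from the slope [l2] of [F], whatever the gap ahead; the additive bound comes
     from the deficit of gap [n], then in slot 0. *)
  assert (Hend : forall q, (K <= q)%nat ->
     (1 - l2) * h q <= D (S n + S q * N) 0%nat /\
     h q - l2 * Rmax 0 (a - D (n + S q * N) 0%nat) <= D (S n + S q * N) 0%nat).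
  { intros q Hq. specialize (Hmid q Hq (N - 2)%nat (le_n _)).
    replace (N - 1 - (N - 2))%nat with 1%nat in Hmid by lia.
    replace (S (S n + q * N + (N - 2))) with (n + S q * N)%nat in Hmid by (simpl; lia).
    change (S n + S q * N)%nat with (S (n + S q * N)).
    set (k := (n + S q * N)%nat) in *.
    change (D (S k) 0%nat) with (D (S k) (nx 1)). rewrite D_step by lia.
    pose proof (back_push_upper k Hl) as Hb.
    pose proof (c_nonpos k 2 Hl ltac:(lia)) as Hc.
    assert (Hlip : c k 2%nat - c k 1%nat <= l2 * D k 1%nat).
    { pose proof (X_decr k 1 ltac:(lia)). pose proof (X_range k 1 ltac:(lia)).
      pose proof (X_anti k 2 N ltac:(lia)). rewrite X_last in *.
      pose proof (D_pos k 1 ltac:(lia)).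
      apply clamp_lip; [nra|].
      eapply Rle_trans; [apply F_lip; lra|].
      rewrite Hl, Rmax_right by lra. unfold D. lra. }
    split; [nra|lra]. }
  unfold deficit_decays.
  refine (gap_recursion (fun q => D (S n + q * N) 0%nat) h
            (fun q => Rmax 0 (a - D (n + S q * N) 0%nat)) a (1 - l2) (w / w0) K
            _ _ _ _ _ _ _ _ _).
  - exact Ha.
  - lra.
  - apply Rdiv_lt_0_compat; lra.
  - intros q; apply D_pos; lia.
  - intros q _. unfold h. pose proof (c_nonpos (S n + q * N) 1 Hl ltac:(lia)). lra.
  - intros q _. unfold h. pose proof (back_push_lower (S n + q * N) Hl).
    replace (1 - (1 - l2)) with l2 by ring. lra.
  - intros q Hq. apply Hend, Hq.
  - intros q Hq. replace (1 - (1 - l2)) with l2 by ring. apply Hend, Hq.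
  - intros r Hr. destruct (Hn r Hr) as [C [HC Hq]].
    exists C; split; [exact HC|]. intros q. specialize (Hq (S q)).
    pose proof (pow_lt r q ltac:(lra)). simpl pow in Hq.
    apply Rmax_lub; [nra|]. eapply Rle_trans; [exact Hq|].
    apply Rmult_le_compat_l; [exact HC|]. nra.
Qed.

Lemma deficit_decays_big n : l1 = 0 -> 0 < l2 -> deficit_decays n -> eventually_big n.
Proof.
  intros Hl H2 Hn e He.
  destruct (Hn (1 - l2 / 2) ltac:(lra)) as [C [HC Hq]].
  destruct (pow_eventually_small C (1 - l2 / 2) e ltac:(lra) He) as [K HK].
  assert (Hfire : forall q, (K <= q)%nat -> a - e <= D (n + q * N) 0%nat).
  { intros q Hk. specialize (Hq q). specialize (HK q Hk). lra. }
  (* This goes back in time from the next firing of the front robot: with [l1 = 0] the gap never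
     grows in slots 1 to [N - 1]. *)
  assert (Hback : forall q, (K <= q)%nat -> forall j, (j < N)%nat ->
            a - e <= D (n + S q * N - j) j).
  { intros q Hk. induction j as [|j IH]; intros Hj.
    - rewrite Nat.sub_0_r. apply Hfire; lia.
    - specialize (IH ltac:(lia)).
      assert (HN1 : (N <= n + S q * N)%nat) by (simpl; lia).
      replace (n + S q * N - j)%nat with (S (n + S q * N - S j)) in IH by lia.
      change (D (S (n + S q * N - S j)) j)
        with (D (S (n + S q * N - S j)) (nx (S j))) in IH.
      rewrite D_step in IH by lia.
      assert (c (n + S q * N - S j) (S j) <= c (n + S q * N - S j) (S (S j))); [|lra].
      destruct (Nat.eq_dec (S (S j)) N) as [E|E].
      + rewrite E, c_last. apply c_nonpos; [exact Hl|lia].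
      + apply c_mono_interior; lia. }
  exists (n + K * N)%nat. intros k Hk.
  pose proof (Nat.div_mod_eq (k - n) N) as Hd.
  pose proof (Nat.mod_upper_bound (k - n) N ltac:(lia)) as Hm.
  set (q := ((k - n) / N)%nat) in *. remember ((k - n) mod N)%nat as r eqn:Er.
  assert (HKq : (K <= q)%nat) by nia.
  clearbody q. clear Er. rewrite (Nat.mul_comm N q) in Hd.
  assert (Hnk : (n <= k)%nat) by nia.
  destruct r as [|i].
  - replace k with (n + q * N)%nat by lia. rewrite pos_fire. apply Hfire, HKq.
  - replace k with (S (n + q * N + i)) by lia. rewrite pos_after_fire by lia.
    specialize (Hback q HKq (N - 1 - i)%nat ltac:(lia)).
    replace (n + S q * N - (N - 1 - i))%nat with (S (n + q * N + i)) in Hback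
      by (simpl; lia). exact Hback.
Qed.

Lemma all_big_backward n : l1 = 0 -> 0 < l2 -> always_big n ->
  forall j, eventually_big (n + j) /\ deficit_decays (n + j) /\
    exists K, forall k, (K <= k)%nat -> forall m, (2 <= m)%nat -> pos (S (n + j)) k = m ->
      X k m <= L - a.
Proof.
  intros Hl H2 Hb. induction j as [|j [IH1 [IH2 IH3]]].
  - rewrite Nat.add_0_r. split; [|split].
    + intros e He. exists 0%nat. intros k _. specialize (Hb k). lra.
    + intros r Hr. exists 0. split; [lra|]. intros q. specialize (Hb (n + q * N)%nat).
      rewrite pos_fire in Hb. lra.
    + exists 0%nat. intros k _ m Hm Hp.
      pose proof (pos_lt (S n) k) as Hlt. rewrite Hp in Hlt. destruct m as [|m]; [lia|].
      apply pos_pred in Hp. specialize (Hb k). rewrite Hp in Hb.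
      pose proof (X_anti k 0 m ltac:(lia)). rewrite X_front in *. unfold D in Hb. lra.
  - rewrite Nat.add_succ_r.
    assert (Hd : deficit_decays (S (n + j))) by now apply deficit_decays_succ.
    assert (Hbig : eventually_big (S (n + j))) by now apply deficit_decays_big.
    split; [exact Hbig|]. split; [exact Hd|].
    (* From slot 2 on, two consecutive gaps of at least [a / 2] lie between the robot and slot 0, so
       its phase is at most [L - a]. *)
    destruct (IH1 (a / 2) ltac:(lra)) as [K1 HK1].
    destruct (Hbig (a / 2) ltac:(lra)) as [K2 HK2].
    exists (Nat.max K1 K2). intros k Hk m Hm Hp.
    specialize (HK1 k ltac:(lia)). specialize (HK2 k ltac:(lia)).
    pose proof (pos_lt (S (S (n + j))) k) as Hlt. rewrite Hp in Hlt.
    destruct m as [|[|m]]; try lia.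
    apply pos_pred in Hp. rewrite Hp in HK2. apply pos_pred in Hp. rewrite Hp in HK1.
    pose proof (X_anti k 0 m ltac:(lia)). rewrite X_front in *. unfold D in *. lra.
Qed.

(** * Convergence of all gaps *)

Theorem gaps_converge : ~ (l1 = 0 /\ l2 = 0) ->
  forall e, 0 < e -> exists K, forall k, (K <= k)%nat -> forall m, (m < N)%nat ->
    Rabs (D k m - a) <= e.
Proof.
  intros Hnz e He.
  destruct exists_always_big as [n0 [_ Hb]].
  assert (Hall : forall n, eventually_big n).
  { intros n.
    (* Adding a multiple of [N] renames the same gap by an index that the chain starting at [n0]
       reaches. *)
    assert (H : eventually_big (n + S n0 * N)).
    { destruct (Req_dec l1 0) as [Hl|Hl].
      - replace (n + S n0 * N)%nat with (n0 + (n + S n0 * N - n0))%nat by nia.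
        apply all_big_backward; [exact Hl|lra|exact Hb].
      - replace (n + S n0 * N)%nat with (S n0 + (n + S n0 * N - S n0))%nat by nia.
        apply all_big_forward; [lra|exact Hb]. }
    intros d Hd. destruct (H d Hd) as [K HK]. exists K. intros k Hk.
    specialize (HK k Hk). unfold pos in HK. rewrite slot_period in HK. exact HK. }
  assert (HNp : 0 < INR N) by (apply lt_0_INR; lia).
  (* If all gaps are at least [a - e / N] and they sum to [N * a], none can exceed [a + e]. *)
  set (d := a - e / INR N).
  destruct (eventually_forall_lt (fun n k => d <= D k (pos n k)) N) as [K HK].
  { intros n Hn. apply Hall. apply Rdiv_lt_0_compat; lra. }
  exists K. intros k Hk m Hm.
  assert (HD : forall m', (m' < N)%nat -> d <= D k m').
  { intros m' Hm'. destruct (slot_onto N HN k m' Hm') as [n [Hn <-]].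
    apply HK; auto. }
  pose proof (X_le_of_D k 0 m d ltac:(lia) ltac:(intros; apply HD; lia)) as H1.
  pose proof (X_le_of_D k (S m) (N - S m) d ltac:(lia) ltac:(intros; apply HD; lia)) as H2.
  replace (S m + (N - S m))%nat with N in H2 by lia.
  rewrite X_last, minus_INR, S_INR in H2 by lia. rewrite Nat.add_0_l, X_front in H1.
  assert (Hu : D k m <= INR N * a - (INR N - 1) * d) by (unfold D, L in *; lra).
  assert (Hed : INR N * d = INR N * a - e) by (unfold d; field; lra).
  specialize (HD m Hm).
  assert (e / INR N <= e).
  { assert (1 <= INR N) by (change 1 with (INR 1); apply le_INR; lia).
    apply Rmult_le_reg_r with (INR N); [lra|]. unfold Rdiv.
    rewrite Rmult_assoc, Rinv_l by lra. nra. }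
  assert (Hd : d = a - e / INR N) by reflexivity.
  pose proof (Rdiv_lt_0_compat e (INR N) He HNp).
  clearbody d. apply Rabs_le. lra.
Qed.

End Discrete.

(** * Simulation of the event system *)

Lemma sorted_insert (f : nat -> R) x l :
  StronglySorted (fun i j => f j < f i) l -> (forall y, In y l -> f y <> f x) ->
  exists l', Permutation (x :: l) l' /\ StronglySorted (fun i j => f j < f i) l'.
Proof.
  induction l as [|y l IH]; intros Hs Hx.
  - exists (x :: nil). split; [reflexivity|repeat constructor].
  - apply StronglySorted_inv in Hs. destruct Hs as [Hs Hy].
    destruct (Rlt_dec (f y) (f x)) as [Hlt|Hge].
    + exists (x :: y :: l). split; [reflexivity|].
      constructor; [constructor; assumption|]. constructor; [exact Hlt|].
      eapply Forall_impl; [|exact Hy]. simpl. intros z Hz. lra.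
    + destruct (IH Hs) as [l' [Hp Hs']]; [intros z Hz; apply Hx; right; exact Hz|].
      exists (y :: l'). split; [now rewrite perm_swap, Hp|].
      constructor; [exact Hs'|].
      eapply Permutation_Forall; [exact Hp|]. constructor; [|exact Hy].
      specialize (Hx y (or_introl eq_refl)). lra.
Qed.

Lemma sorted_permutation (f : nat -> R) l : NoDup l ->
  (forall i j, In i l -> In j l -> i <> j -> f i <> f j) ->
  exists l', Permutation l l' /\ StronglySorted (fun i j => f j < f i) l'.
Proof.
  induction l as [|x l IH]; intros Hn Hf.
  - exists nil. split; [reflexivity|constructor].
  - inversion Hn as [|? ? Hx Hl]; subst.
    destruct (IH Hl) as [l1 [Hp1 Hs1]]; [intros; apply Hf; simpl; auto|].
    destruct (sorted_insert f x l1 Hs1) as [l2 [Hp2 Hs2]].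
    { intros y Hy. apply Hf; [right|left; reflexivity|].
      - now apply (Permutation_in _ (Permutation_sym Hp1)).
      - intros ->. apply Hx. now apply (Permutation_in _ (Permutation_sym Hp1)). }
    exists l2. split; [now rewrite Hp1|exact Hs2].
Qed.

Lemma StronglySorted_nth (f : nat -> R) l : StronglySorted (fun i j => f j < f i) l ->
  forall m m', (m < m' < length l)%nat -> f (nth m' l 0%nat) < f (nth m l 0%nat).
Proof.
  induction l as [|x l IH]; intros Hs m m' Hm; simpl in *; [lia|].
  apply StronglySorted_inv in Hs. destruct Hs as [Hs Hx].
  destruct m' as [|m']; [lia|]. destruct m as [|m].
  - rewrite Forall_forall in Hx. apply Hx, nth_In. lia.
  - apply IH; [exact Hs|lia].
Qed.

Lemma exists_decreasing_order (N : nat) (f : nat -> R) :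
  (forall i j, (i < N)%nat -> (j < N)%nat -> i <> j -> f i <> f j) ->
  exists sigma : nat -> nat,
    (forall m, (m < N)%nat -> (sigma m < N)%nat) /\
    (forall i, (i < N)%nat -> exists m, (m < N)%nat /\ sigma m = i) /\
    (forall m m', (m < m' < N)%nat -> f (sigma m') < f (sigma m)).
Proof.
  intros Hf. destruct (sorted_permutation f (seq 0 N) (seq_NoDup N 0)) as [l [Hp Hs]].
  { intros i j Hi Hj. apply in_seq in Hi, Hj. apply Hf; lia. }
  assert (Hlen : length l = N) by (rewrite <- (Permutation_length Hp); apply length_seq).
  exists (fun m => nth m l 0%nat). split; [|split].
  - intros m Hm. assert (Hin : In (nth m l 0%nat) (seq 0 N)).
    { apply (Permutation_in _ (Permutation_sym Hp)), nth_In. lia. }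
    apply in_seq in Hin. lia.
  - intros i Hi. destruct (In_nth l i 0%nat) as [m [Hm He]].
    + apply (Permutation_in _ Hp), in_seq. lia.
    + exists m. split; [lia|exact He].
  - intros m m' Hm. apply StronglySorted_nth; [exact Hs|lia].
Qed.

Lemma rmod2pi_spec x : exists z, rmod2pi x = x - 2 * PI * IZR z.
Proof. exists (up (x / (2 * PI)) - 1)%Z. unfold rmod2pi. rewrite minus_IZR. reflexivity. Qed.

Lemma rmod2pi_unique x g z : 0 <= g < 2 * PI -> x = g + 2 * PI * IZR z -> rmod2pi x = g.
Proof.
  intros Hg ->. unfold rmod2pi. pose proof PI_RGT_0.
  assert (Hq : (g + 2 * PI * IZR z) / (2 * PI) = g / (2 * PI) + IZR z) by (field; lra).
  assert (Hg' : 0 <= g / (2 * PI) < 1).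
  { split; [apply Rle_mult_inv_pos; lra|].
    apply Rmult_lt_reg_r with (2 * PI); [lra|]. unfold Rdiv.
    rewrite Rmult_assoc, Rinv_l by lra. lra. }
  rewrite Hq.
  replace (up (g / (2 * PI) + IZR z)) with (z + 1)%Z.
  - rewrite plus_IZR. ring.
  - apply tech_up; rewrite plus_IZR; lra.
Qed.

Lemma rmod2pi_sub x y g z : 0 <= g < 2 * PI -> x - y = g + 2 * PI * IZR z ->
  rmod2pi (rmod2pi x - rmod2pi y) = g.
Proof.
  intros Hg Hxy. destruct (rmod2pi_spec x) as [zx ->]. destruct (rmod2pi_spec y) as [zy ->].
  apply rmod2pi_unique with (z := (z - zx + zy)%Z); [exact Hg|].
  rewrite plus_IZR, minus_IZR. lra.
Qed.

Lemma PRF_0 N l1 l2 : PRF N l1 l2 0 = 0.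
Proof. unfold PRF. destruct (Rlt_dec 0 0); lra. Qed.

Lemma PRF_formula N l1 l2 x : (2 <= N)%nat -> 0 < x < INR N * (2 * PI / INR N) ->
  PRF N l1 l2 x = l1 * Rmax 0 (2 * PI / INR N - x)
    - l2 * Rmax 0 (x - (INR N * (2 * PI / INR N) - 2 * PI / INR N)).
Proof.
  intros HN Hx. assert (HNp : 2 <= INR N) by (apply le_INR in HN; simpl in HN; lra).
  pose proof PI_RGT_0. unfold PRF.
  replace (2 * PI * (INR N - 1) / INR N)
    with (INR N * (2 * PI / INR N) - 2 * PI / INR N) by (field; lra).
  set (a := 2 * PI / INR N) in *.
  replace (2 * PI) with (INR N * a) in * by (unfold a; field; lra).
  assert (0 < a) by nra. assert (2 * a <= INR N * a) by nra.
  unfold Rmax; repeat destruct Rlt_dec; repeat destruct Rle_dec; try lra;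
  try (replace (a - x) with 0 by lra);
  try (replace (x - (INR N * a - a)) with 0 by lra); lra.
Qed.

Lemma PRF_2PI N l1 l2 : (2 <= N)%nat -> PRF N l1 l2 (2 * PI) = 0.
Proof.
  intros HN. assert (HNp : 2 <= INR N) by (apply le_INR in HN; simpl in HN; lra).
  pose proof PI_RGT_0. unfold PRF.
  assert (2 * PI / INR N < 2 * PI).
  { apply Rmult_lt_reg_r with (INR N); [lra|]. unfold Rdiv.
    rewrite Rmult_assoc, Rinv_l by lra. nra. }
  repeat destruct Rlt_dec; lra.
Qed.

Definition event (w0 w : R) (s : state) (i : nat) (x : R) : Prop :=
  fire_time w0 w s i = Some x \/ end_time s i = Some x.

(** The existence of an event excludes the branch where [next_dt] takes its default value 0. *)
Lemma next_dt_spec N w0 w s :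
  (exists i x, (i < N)%nat /\ event w0 w s i x) ->
  (exists i, (i < N)%nat /\ event w0 w s i (next_dt N w0 w s)) /\
  (forall i x, (i < N)%nat -> event w0 w s i x -> next_dt N w0 w s <= x).
Proof.
  intros [i0 [x0 [Hi0 Hx0]]]. unfold next_dt.
  assert (H : forall l,
    match fold_right (fun i acc => omin (omin (fire_time w0 w s i) (end_time s i)) acc) None l with
    | Some y => (exists i, In i l /\ event w0 w s i y) /\
                (forall i x, In i l -> event w0 w s i x -> y <= x)
    | None => forall i x, In i l -> ~ event w0 w s i x
    end).
  { induction l as [|j l IH]; simpl; [tauto|].
    destruct (fold_right _ _ l) as [y|].
    - destruct IH as [[i [Hi Hy]] Hmin].
      destruct (fire_time w0 w s j) as [f|] eqn:Ef; destruct (end_time s j) as [e|] eqn:Ee;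
      simpl; (split; [|intros i' x' [<-|Hi'] He';
        [unfold event in He'; rewrite Ef, Ee in He'; destruct He' as [He'|He']; inversion He'; subst
        |specialize (Hmin i' x' Hi' He')];
        unfold Rmin in *; repeat destruct Rle_dec; lra]).
      + unfold Rmin; repeat destruct Rle_dec; first [exists j; split; [now left|unfold event; tauto]
          |exists i; split; [now right|assumption]].
      + unfold Rmin; repeat destruct Rle_dec; first [exists j; split; [now left|unfold event; tauto]
          |exists i; split; [now right|assumption]].
      + unfold Rmin; repeat destruct Rle_dec; first [exists j; split; [now left|unfold event; tauto]
          |exists i; split; [now right|assumption]].
      + exists i; split; [now right|assumption].
    - destruct (fire_time w0 w s j) as [f|] eqn:Ef; destruct (end_time s j) as [e|] eqn:Ee;
      simpl.
      4: { intros i' x' [<-|Hi'] He'; [|now apply (IH i' x')].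
           unfold event in He'; rewrite Ef, Ee in He'; destruct He'; discriminate. }
      all: split; [exists j; split; [now left|unfold event, Rmin; try destruct Rle_dec; tauto]
                  |intros i' x' [<-|Hi'] He'; [|exfalso; now apply (IH i' x')]];
        unfold event in He'; rewrite Ef, Ee in He'; destruct He' as [He'|He']; inversion He'; subst;
        unfold Rmin; try destruct Rle_dec; lra. }
  specialize (H (seq 0 N)). destruct (fold_right _ _ (seq 0 N)) as [y|].
  - destruct H as [[i [Hi Hy]] Hmin]. split.
    + exists i. apply in_seq in Hi. split; [lia|exact Hy].
    + intros j x Hj. apply Hmin, in_seq. lia.
  - exfalso. apply (H i0 x0); [apply in_seq; lia|exact Hx0].
Qed.

Lemma Rabs_sgn_cases u : (0 < u /\ Rabs u = u /\ sgn u = 1) \/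
  (u < 0 /\ Rabs u = - u /\ sgn u = -1) \/ (u = 0 /\ Rabs u = 0 /\ sgn u = 0).
Proof.
  unfold sgn. destruct (Rlt_dec 0 u); [left|right].
  - rewrite Rabs_pos_eq; lra.
  - destruct (Rlt_dec u 0); [left|right].
    + rewrite Rabs_left; lra.
    + assert (u = 0) by lra. subst. rewrite Rabs_R0. lra.
Qed.

(** * Motion between two pulses *)

Section Events.
Variables (N : nat) (w0 w l1 l2 : R).
Hypothesis Hw0 : 0 < w0.
Hypothesis Hw : 0 < w.

(** Closed form of the phase at time [t] after an adjustment [u] was assigned at phase [x], without
    reset. [dir_at] and [rem_at] are the matching state fields; the direction is already 0 at the
    instant [w * t = Rabs u]. *)
Definition path (x u t : R) : R := x + w0 * t + clamp u (w * t).
Definition dir_at (u t : R) : R := if Rlt_dec (w * t) (Rabs u) then sgn u else 0.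
Definition rem_at (u t : R) : R := if Rlt_dec (w * t) (Rabs u) then Rabs u / w - t else 0.

(* [t] is the time elapsed since the last pulse, at which robot [i] had phase [xs i] and
   was assigned the adjustment [us i]. *)
Definition follows (s : state) (xs us : nat -> R) (t : R) : Prop :=
  forall i, (i < N)%nat ->
    ph s i = path (xs i) (us i) t /\ dir s i = dir_at (us i) t /\ rem s i = rem_at (us i) t.

Lemma le_div_iff u x : u <= x / w <-> w * u <= x.
Proof.
  split; intros H.
  - apply Rmult_le_compat_l with (r := w) in H; [|lra].
    replace (w * (x / w)) with x in H by (field; lra). exact H.
  - apply Rmult_le_reg_l with w; [lra|]. replace (w * (x / w)) with x by (field; lra). exact H.
Qed.

(** The bound on [h] keeps the motion within one linear piece of [clamp]. *)
Lemma path_flow x u t h : 0 <= t -> 0 <= h -> (dir_at u t <> 0 -> h <= rem_at u t) ->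
  path x u t + (w0 + dir_at u t * w) * h = path x u (t + h).
Proof.
  intros Ht Hh. unfold path, dir_at, rem_at.
  assert (Hwt : 0 <= w * t) by nra. assert (Hwh : 0 <= w * h) by nra.
  destruct (Rabs_sgn_cases u) as [[Hu [Hab Hs]]|[[Hu [Hab Hs]]|[Hu [Hab Hs]]]];
  rewrite Hab, Hs; destruct (Rlt_dec _ _) as [Hlt|Hge]; intros Hd.
  - specialize (Hd ltac:(lra)). assert (Hth : t + h <= u / w) by lra.
    apply le_div_iff in Hth. rewrite Rmult_plus_distr_l in *. clamp_cases; lra.
  - rewrite Rmult_plus_distr_l in *. clamp_cases; lra.
  - specialize (Hd ltac:(lra)). assert (Hth : t + h <= - u / w) by lra.
    apply le_div_iff in Hth. rewrite Rmult_plus_distr_l in *. clamp_cases; lra.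
  - rewrite Rmult_plus_distr_l in *. clamp_cases; lra.
  - lra.
  - rewrite Rmult_plus_distr_l in *. clamp_cases; lra.
Qed.

Lemma path_0 x u : path x u 0 = x.
Proof. unfold path. rewrite !Rmult_0_r. clamp_cases; lra. Qed.

Lemma dir_at_0 u : dir_at u 0 = sgn u.
Proof.
  unfold dir_at. rewrite Rmult_0_r.
  destruct (Rabs_sgn_cases u) as [H|[H|H]]; destruct (Rlt_dec _ _); lra.
Qed.

Lemma rem_at_0 u : rem_at u 0 = Rabs u / w.
Proof.
  unfold rem_at. rewrite Rmult_0_r.
  destruct (Rabs_sgn_cases u) as [H|[H|H]]; destruct (Rlt_dec _ _); try lra.
  destruct H as [_ [-> _]]. unfold Rdiv. lra.
Qed.

Lemma dir_at_neq u t : dir_at u t <> 0 -> w * t < Rabs u.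
Proof. unfold dir_at. destruct (Rlt_dec _ _); [intros _; assumption|lra]. Qed.

Lemma dir_at_abs u t : Rabs (dir_at u t * w) <= w.
Proof.
  unfold dir_at. apply Rabs_le.
  destruct (Rlt_dec _ _); [|lra].
  destruct (Rabs_sgn_cases u) as [[_ [_ ->]]|[[_ [_ ->]]|[_ [_ ->]]]]; lra.
Qed.

Lemma dir_rem_lt u t h : 0 <= t -> 0 < h -> dir_at u t <> 0 -> h < rem_at u t ->
  dir_at u (t + h) = dir_at u t /\ rem_at u (t + h) = rem_at u t - h.
Proof.
  intros Ht Hh Hd Hr. pose proof (dir_at_neq u t Hd) as Hlt.
  unfold dir_at, rem_at in *. destruct (Rlt_dec (w * t) (Rabs u)); [|lra].
  assert (w * (t + h) < Rabs u).
  { apply Rmult_lt_compat_l with (r := w) in Hr; [|lra].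
    replace (w * (Rabs u / w - t)) with (Rabs u - w * t) in Hr by (field; lra). lra. }
  destruct (Rlt_dec (w * (t + h)) (Rabs u)); lra.
Qed.

Lemma dir_rem_done u t : Rabs u <= w * t -> dir_at u t = 0 /\ rem_at u t = 0.
Proof. intros H. unfold dir_at, rem_at. destruct (Rlt_dec _ _); lra. Qed.

Lemma rem_at_eq u t h : dir_at u t <> 0 -> h = rem_at u t -> Rabs u = w * (t + h).
Proof.
  intros Hd ->. pose proof (dir_at_neq u t Hd). unfold rem_at.
  destruct (Rlt_dec _ _); [|lra]. field; lra.
Qed.

Lemma is_some_eq_spec o x : is_some_eq o x = true <-> o = Some x.
Proof.
  destruct o as [y|]; simpl; [|split; discriminate].
  destruct (Req_EM_T y x) as [->|H]; split; intros; try reflexivity; try discriminate.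
  inversion H0; contradiction.
Qed.

(** If [i0] alone reaches [2 * PI] first, at time [T0], then a step either ends some adjustment
    before [T0] or is the pulse itself. The adjustment exhibited in the first case makes the number
    of steps before the pulse finite. *)
Lemma step_follows s xs us t i0 T0 :
  follows s xs us t -> 0 <= t < T0 -> (i0 < N)%nat ->
  path (xs i0) (us i0) T0 = 2 * PI ->
  (forall i, (i < N)%nat -> forall t', 0 <= t' < T0 -> path (xs i) (us i) t' < 2 * PI) ->
  (forall i, (i < N)%nat -> i <> i0 -> path (xs i) (us i) T0 < 2 * PI) ->
  let dt := next_dt N w0 w s in
  let xs' i := if Nat.eq_dec i i0 then 0 else path (xs i) (us i) T0 in
  0 < dt /\ t + dt <= T0 /\
  (forall i, (i < N)%nat -> forall h, 0 <= h <= dt ->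
     ph s i + rate w0 w s i * h = path (xs i) (us i) (t + h)) /\
  ((t + dt < T0 /\ follows (step N w0 w l1 l2 s) xs us (t + dt) /\
    exists i, (i < N)%nat /\ dir_at (us i) t <> 0 /\ dir_at (us i) (t + dt) = 0) \/
   (t + dt = T0 /\ follows (step N w0 w l1 l2 s) xs' (fun i => PRF N l1 l2 (xs' i)) 0)).
Proof.
  intros Hs Ht Hi0 Hlead Hbelow Hother dt xs'.
  assert (Hph : forall i, (i < N)%nat -> ph s i < 2 * PI).
  { intros i Hi. destruct (Hs i Hi) as [-> _]. apply Hbelow; [exact Hi|lra]. }
  assert (Hend : forall i x, (i < N)%nat ->
            end_time s i = Some x <-> dir_at (us i) t <> 0 /\ x = rem_at (us i) t).
  { intros i x Hi. destruct (Hs i Hi) as [_ [Hd Hr]]. unfold end_time.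
    rewrite Hd, Hr. destruct (Req_EM_T _ _); split; intros H; try discriminate; try tauto.
    - inversion H; auto.
    - destruct H as [_ ->]; reflexivity. }
  assert (Hfire : forall i x, fire_time w0 w s i = Some x <->
            0 < rate w0 w s i /\ ph s i + rate w0 w s i * x = 2 * PI).
  { intros i x. unfold fire_time. destruct (Rlt_dec _ _) as [Hp|Hp]; split; intros H.
    - inversion H; subst. split; [exact Hp|field; lra].
    - destruct H as [_ H]. f_equal. apply Rmult_eq_reg_l with (rate w0 w s i); [|lra].
      replace (rate w0 w s i * ((2 * PI - ph s i) / rate w0 w s i)) with (2 * PI - ph s i)
        by (field; lra). lra.
    - discriminate.
    - lra. }
  (* An event exists: [i0] either runs an adjustment, which will end, or moves at rate [w0 > 0] and
     will fire. *)
  destruct (next_dt_spec N w0 w s) as [[j [Hj Hatt]] Hmin].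
  { destruct (Req_EM_T (dir_at (us i0) t) 0) as [Hd|Hd].
    - exists i0, ((2 * PI - ph s i0) / w0). split; [exact Hi0|left].
      destruct (Hs i0 Hi0) as [_ [Hd' _]].
      apply Hfire. unfold rate. rewrite Hd', Hd. split; [lra|field; lra].
    - exists i0, (rem_at (us i0) t). split; [exact Hi0|right]. now apply Hend. }
  fold dt in Hatt, Hmin.
  assert (Hdt : 0 < dt).
  { destruct Hatt as [H|H].
    - apply Hfire in H. specialize (Hph j Hj). nra.
    - apply Hend in H; [|exact Hj]. destruct H as [Hd ->].
      pose proof (dir_at_neq _ _ Hd). unfold rem_at. destruct (Rlt_dec _ _); [|lra].
      assert (t < Rabs (us j) / w); [|lra].
      apply Rmult_lt_reg_l with w; [lra|].
      replace (w * (Rabs (us j) / w)) with (Rabs (us j)) by (field; lra). lra. }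
  assert (Hrem : forall i, (i < N)%nat -> dir_at (us i) t <> 0 -> dt <= rem_at (us i) t).
  { intros i Hi Hd. apply (Hmin i); [exact Hi|right]. now apply Hend. }
  assert (Hflow : forall i, (i < N)%nat -> forall h, 0 <= h <= dt ->
            ph s i + rate w0 w s i * h = path (xs i) (us i) (t + h)).
  { intros i Hi h Hh. destruct (Hs i Hi) as [Hp [Hd _]]. unfold rate. rewrite Hp, Hd.
    apply path_flow; [lra|lra|]. intros Hne. specialize (Hrem i Hi Hne). lra. }
  (* Otherwise [i0] would reach [2 * PI] within this linear stretch, and its firing would be an
     earlier event. *)
  assert (HleT : t + dt <= T0).
  { apply Rnot_lt_le. intros Hlt.
    specialize (Hflow i0 Hi0 (T0 - t) ltac:(lra)).
    replace (t + (T0 - t)) with T0 in Hflow by ring. rewrite Hlead in Hflow.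
    specialize (Hph i0 Hi0).
    assert (dt <= T0 - t); [|lra].
    apply (Hmin i0); [exact Hi0|left]. apply Hfire. split; [nra|exact Hflow]. }
  assert (Hfires : forall i, (i < N)%nat ->
            fires N w0 w s i = true <-> path (xs i) (us i) (t + dt) = 2 * PI).
  { intros i Hi. unfold fires. fold dt. rewrite is_some_eq_spec, Hfire, Hflow by (auto; lra).
    split; [tauto|]. intros H. split; [|exact H].
    specialize (Hph i Hi). rewrite <- (Hflow i Hi dt) in H by lra. nra. }
  split; [exact Hdt|]. split; [exact HleT|]. split; [exact Hflow|].
  destruct (Rle_lt_or_eq_dec _ _ HleT) as [Hlt|Heq]; [left|right].
  - assert (Hno : forall i, (i < N)%nat -> fires N w0 w s i = false).
    { intros i Hi. apply Bool.not_true_is_false. rewrite Hfires by exact Hi.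
      specialize (Hbelow i Hi (t + dt) ltac:(lra)). lra. }
    assert (Hany : any_fires N w0 w s = false).
    { apply Bool.not_true_is_false. intros H. apply existsb_exists in H.
      destruct H as [i [Hi H]]. apply in_seq in Hi. rewrite Hno in H by lia. discriminate. }
    split; [exact Hlt|]. split.
    + intros i Hi. unfold step. simpl. fold dt. rewrite Hno, Hany by exact Hi.
      destruct (Hs i Hi) as [_ [Hd Hr]]. specialize (Hrem i Hi).
      split; [apply Hflow; [exact Hi|lra]|].
      destruct (Req_EM_T (dir s i) 0) as [Hd0|Hd0].
      * assert (He : is_some_eq (end_time s i) dt = false).
        { unfold end_time. destruct (Req_EM_T (dir s i) 0); [reflexivity|contradiction]. }
        rewrite He, Hd0.
        assert (Hab : Rabs (us i) <= w * t).
        { apply Rnot_lt_le. intros Hc. rewrite Hd in Hd0. unfold dir_at in Hd0.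
          destruct (Rlt_dec _ _); [|lra].
          destruct (Rabs_sgn_cases (us i)) as [?|[?|?]]; nra. }
        destruct (dir_rem_done (us i) (t + dt)) as [-> ->]; [nra|split; reflexivity].
      * rewrite Hd in Hd0. specialize (Hrem Hd0).
        destruct (Rle_lt_or_eq_dec _ _ Hrem) as [Hl|He].
        -- assert (He : is_some_eq (end_time s i) dt = false).
           { apply Bool.not_true_is_false. rewrite is_some_eq_spec, Hend by exact Hi. lra. }
           rewrite He, Hd, Hr.
           destruct (dir_rem_lt (us i) t dt) as [-> ->]; [lra|exact Hdt|exact Hd0|exact Hl|].
           split; reflexivity.
        -- assert (He' : is_some_eq (end_time s i) dt = true).
           { apply is_some_eq_spec, Hend; auto. }
           rewrite He'.
           destruct (dir_rem_done (us i) (t + dt)) as [-> ->]; [|split; reflexivity].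
           right. now apply rem_at_eq.
    + exists j. split; [exact Hj|].
      destruct Hatt as [H|H].
      * specialize (Hno j Hj). unfold fires in Hno. fold dt in Hno.
        apply is_some_eq_spec in H. congruence.
      * apply Hend in H; [|exact Hj]. destruct H as [Hd He]. split; [exact Hd|].
        apply dir_rem_done. right. now apply rem_at_eq.
  - assert (Hf0 : fires N w0 w s i0 = true) by (apply Hfires; [exact Hi0|now rewrite Heq]).
    assert (Hany : any_fires N w0 w s = true).
    { apply existsb_exists. exists i0. split; [apply in_seq; lia|exact Hf0]. }
    split; [exact Heq|].
    intros i Hi. unfold step. simpl. fold dt.
    rewrite path_0, dir_at_0, rem_at_0. unfold xs'.
    destruct (Nat.eq_dec i i0) as [->|Hne].
    + rewrite Hf0, PRF_0, Rabs_R0. unfold sgn, Rdiv.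
      repeat (destruct Rlt_dec; [lra|]). lra.
    + assert (Hf : fires N w0 w s i = false).
      { apply Bool.not_true_is_false. rewrite Hfires, Heq by exact Hi.
        specialize (Hother i Hi Hne). lra. }
      rewrite Hf, Hany, Hflow, Heq by (auto; lra). split; [|split]; reflexivity.
Qed.

End Events.

Lemma filter_length_lt {A : Type} (P P' : A -> bool) l :
  (forall x, P' x = true -> P x = true) ->
  (exists x, In x l /\ P x = true /\ P' x = false) ->
  (length (filter P' l) < length (filter P l))%nat.
Proof.
  intros Himp.
  assert (Hle : forall l, (length (filter P' l) <= length (filter P l))%nat).
  { induction l0 as [|x l0 IH]; simpl; [lia|]. specialize (Himp x).
    destruct (P' x); destruct (P x); simpl; lia. }
  induction l as [|x l IH]; intros [y [Hy [HP HP']]]; [destruct Hy|].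
  simpl. destruct Hy as [->|Hy].
  - rewrite HP, HP'. simpl. specialize (Hle l). lia.
  - specialize (IH (ex_intro _ y (conj Hy (conj HP HP')))). specialize (Himp x).
    destruct (P' x); destruct (P x); simpl; lia.
Qed.

Lemma decreasing_steps (Y : nat -> R) (N : nat) :
  (forall m, (m < N)%nat -> Y (S m) < Y m) ->
  forall m m', (m < m' <= N)%nat -> Y m' < Y m.
Proof.
  intros HY m m' [Hlt Hle]. induction Hlt as [|m' Hlt IH]; [apply HY; lia|].
  specialize (IH ltac:(lia)). specialize (HY m' ltac:(lia)). lra.
Qed.

(** * Time until a robot fires *)

Section Delay.
Variables (w0 w : R).
Hypothesis Hw0 : 0 < w0.
Hypothesis Hw : 0 < w.

(* The first time [t] with [path w0 w x u t = 2 * PI], for [x < 2 * PI]. *)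
Definition delay (x u : R) : R :=
  if Rlt_dec u 0 then
    if Rlt_dec w w0 then Rmin ((2 * PI - x) / (w0 - w)) ((2 * PI - x - u) / w0)
    else (2 * PI - x - u) / w0
  else Rmax ((2 * PI - x) / (w0 + w)) ((2 * PI - x - u) / w0).

(** For [u < 0] the path is the maximum of the lines of slopes [w0 - w] and [w0], so the earlier hit
    counts; the first line rises only if [w < w0]. For [u >= 0] it is the minimum of the lines of
    slopes [w0 + w] and [w0], so the later hit counts. *)
Lemma delay_spec x u : x < 2 * PI ->
  0 < delay x u /\ path w0 w x u (delay x u) = 2 * PI /\
  (forall t, 0 <= t < delay x u -> path w0 w x u t < 2 * PI).
Proof.
  intros Hx. unfold delay, path.
  assert (H2 : w0 * ((2 * PI - x - u) / w0) = 2 * PI - x - u) by (field; lra).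
  set (t2 := (2 * PI - x - u) / w0) in *.
  destruct (Rlt_dec u 0) as [Hu|Hu].
  - assert (Ht2 : 0 < t2) by (unfold t2; apply Rdiv_lt_0_compat; lra).
    destruct (Rlt_dec w w0) as [Hlt|Hge].
    + assert (H1 : (w0 - w) * ((2 * PI - x) / (w0 - w)) = 2 * PI - x) by (field; lra).
      assert (Ht1 : 0 < (2 * PI - x) / (w0 - w)) by (apply Rdiv_lt_0_compat; lra).
      set (t1 := (2 * PI - x) / (w0 - w)) in *. clearbody t1 t2.
      destruct (Rle_lt_dec t1 t2) as [Hle|Hle];
      [rewrite Rmin_left by lra|rewrite Rmin_right by lra].
      * split; [lra|]. split.
        -- assert (w0 * t1 <= w0 * t2) by (apply Rmult_le_compat_l; lra).
           assert (0 < w * t1) by nra. clamp_cases; lra.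
        -- intros t Ht. assert ((w0 - w) * t < (w0 - w) * t1) by (apply Rmult_lt_compat_l; lra).
           assert (w0 * t < w0 * t2) by (apply Rmult_lt_compat_l; lra).
           assert (0 <= w * t) by nra. clamp_cases; lra.
      * split; [lra|]. split.
        -- assert ((w0 - w) * t2 <= (w0 - w) * t1) by (apply Rmult_le_compat_l; lra).
           assert (0 < w * t2) by nra. clamp_cases; lra.
        -- intros t Ht. assert ((w0 - w) * t < (w0 - w) * t1) by (apply Rmult_lt_compat_l; lra).
           assert (w0 * t < w0 * t2) by (apply Rmult_lt_compat_l; lra).
           assert (0 <= w * t) by nra. clamp_cases; lra.
    + clearbody t2. split; [lra|]. split.
      * assert (0 <= (w - w0) * t2) by (apply Rmult_le_pos; lra). clamp_cases; lra.
      * intros t Ht. assert (w0 * t < w0 * t2) by (apply Rmult_lt_compat_l; lra).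
        assert (0 <= (w - w0) * t) by (apply Rmult_le_pos; lra).
        assert (0 <= w * t) by nra. clamp_cases; lra.
  - assert (H1 : (w0 + w) * ((2 * PI - x) / (w0 + w)) = 2 * PI - x) by (field; lra).
    assert (Ht1 : 0 < (2 * PI - x) / (w0 + w)) by (apply Rdiv_lt_0_compat; lra).
    set (t1 := (2 * PI - x) / (w0 + w)) in *. clearbody t1 t2.
    destruct (Rle_lt_dec t1 t2) as [Hle|Hle];
    [rewrite Rmax_right by lra|rewrite Rmax_left by lra].
    + split; [lra|]. split.
      * assert ((w0 + w) * t1 <= (w0 + w) * t2) by (apply Rmult_le_compat_l; lra).
        clamp_cases; nra.
      * intros t Ht. assert (w0 * t < w0 * t2) by (apply Rmult_lt_compat_l; lra).
        assert (0 <= w * t) by nra. clamp_cases; lra.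
    + split; [lra|]. split.
      * assert (w0 * t2 <= w0 * t1) by (apply Rmult_le_compat_l; lra).
        assert (0 <= w * t1) by nra. clamp_cases; lra.
      * intros t Ht. assert ((w0 + w) * t < (w0 + w) * t1) by (apply Rmult_lt_compat_l; lra).
        assert (0 <= w * t) by nra. clamp_cases; lra.
Qed.

End Delay.

(** * The trajectory computed from pulse to pulse *)

Section Trajectory.
Variables (N : nat) (w0 w l1 l2 : R) (th0 : nat -> R) (sigma : nat -> nat).
Hypothesis HN : (2 <= N)%nat.
Hypothesis Hw0 : 0 < w0.
Hypothesis Hw : 0 < w.
Hypothesis Hl1 : 0 <= l1 < 1.
Hypothesis Hl2 : 0 <= l2 < 1.
Hypothesis Hth : forall i, (i < N)%nat -> 0 <= th0 i < 2 * PI.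
Hypothesis sigma_lt : forall m, (m < N)%nat -> (sigma m < N)%nat.
Hypothesis sigma_onto : forall i, (i < N)%nat -> exists m, (m < N)%nat /\ sigma m = i.
Hypothesis sigma_decr : forall m m', (m < m' < N)%nat -> th0 (sigma m') < th0 (sigma m).
Let F := PRF N l1 l2.
Let a := 2 * PI / INR N.

(* The robot that fires at the [n]-th pulse, pulses being numbered from 0. *)
Definition rob (n : nat) : nat := sigma (n mod N).

(** Phase of robot [i] right after pulse [k], skipping the intermediate ends of adjustments. It
    presupposes the cyclic firing order, which [X_decreasing] justifies. *)
Fixpoint base (k : nat) (i : nat) : R :=
  match k with
  | O => if Nat.eq_dec i (rob 0) then 0 else th0 i + (2 * PI - th0 (rob 0))
  | S k' => let x := base k' (rob (S k')) in
      if Nat.eq_dec i (rob (S k')) then 0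
      else path w0 w (base k' i) (F (base k' i)) (delay w0 w x (F x))
  end.

Let T (k : nat) : R := delay w0 w (base k (rob (S k))) (F (base k (rob (S k)))).
Let us (k : nat) (i : nat) : R := F (base k i).

(* Phases after the [k]-th pulse in the order of firing; the robot that just fired is
   counted twice, at [2 * PI] in slot 0 and at 0 in slot [N]. *)
Let X (k m : nat) : R := match m with O => 2 * PI | S _ => base k (rob (k + m)) end.

Fixpoint pulse_time (k : nat) : R :=
  match k with
  | O => (2 * PI - th0 (rob 0)) / w0
  | S k' => pulse_time k' + T k'
  end.

Lemma N_a : INR N * a = 2 * PI.
Proof. unfold a. field. apply not_0_INR. lia. Qed.

Lemma a_pos : 0 < a.
Proof.
  unfold a. pose proof PI_RGT_0. apply Rdiv_lt_0_compat; [lra|apply lt_0_INR; lia].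
Qed.

Lemma F_formula x : 0 < x < INR N * a ->
  F x = l1 * Rmax 0 (a - x) - l2 * Rmax 0 (x - (INR N * a - a)).
Proof. apply PRF_formula, HN. Qed.

Lemma rob_lt n : (rob n < N)%nat.
Proof. apply sigma_lt, Nat.mod_upper_bound. lia. Qed.

Lemma rob_period n : rob (n + N) = rob n.
Proof.
  unfold rob. replace (n + N)%nat with (n + 1 * N)%nat by lia.
  now rewrite Nat.Div0.mod_add.
Qed.

Lemma sigma_inj m m' : (m < N)%nat -> (m' < N)%nat -> sigma m = sigma m' -> m = m'.
Proof.
  intros Hm Hm' He. destruct (Nat.lt_trichotomy m m') as [H|[H|H]]; [|exact H|].
  - pose proof (sigma_decr m m' ltac:(lia)) as Hd. rewrite He in Hd. lra.
  - pose proof (sigma_decr m' m ltac:(lia)) as Hd. rewrite He in Hd. lra.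
Qed.

Lemma rob_neq n d : (0 < d < N)%nat -> rob (n + d) <> rob n.
Proof.
  intros Hd He. apply sigma_inj in He; try (apply Nat.mod_upper_bound; lia).
  pose proof (Nat.div_mod_eq (n + d) N) as H1. pose proof (Nat.div_mod_eq n N) as H2.
  rewrite He in H1.
  assert (HdN : d = (N * ((n + d) / N - n / N))%nat) by nia.
  destruct ((n + d) / N - n / N)%nat; nia.
Qed.

Lemma rob_cover k i : (i < N)%nat -> exists m, (1 <= m <= N)%nat /\ rob (k + m) = i.
Proof.
  intros Hi. destruct (sigma_onto i Hi) as [m0 [Hm0 <-]].
  pose proof (Nat.div_mod_eq k N) as Hk.
  pose proof (Nat.mod_upper_bound k N ltac:(lia)) as Hr.
  assert (Hrob : forall m q, (k + m = N * q + m0)%nat -> rob (k + m) = sigma m0).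
  { intros m q H. unfold rob. f_equal. symmetry. now apply Nat.mod_unique with q. }
  destruct (Nat.le_gt_cases m0 (k mod N)) as [H|H].
  - exists (m0 + N - k mod N)%nat. split; [lia|].
    apply Hrob with (q := S (k / N)). rewrite Nat.mul_succ_r. lia.
  - exists (m0 - k mod N)%nat. split; [lia|]. apply Hrob with (q := (k / N)%nat). lia.
Qed.

Lemma base_rob k m : (0 < m)%nat -> base k (rob (k + m)) = X k m.
Proof. destruct m; [lia|reflexivity]. Qed.

Lemma base_fired k : base k (rob k) = 0.
Proof. destruct k; simpl; destruct Nat.eq_dec; congruence. Qed.

Lemma X_N k : X k N = 0.
Proof. rewrite <- base_rob by lia. rewrite rob_period. apply base_fired. Qed.

Lemma X_succ k m : X k 1 < 2 * PI -> (m < N)%nat ->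
  X (S k) m = path w0 w (X k (S m)) (F (X k (S m))) (T k).
Proof.
  intros HX Hm. assert (HX1 : base k (rob (S k)) = X k 1).
  { rewrite <- base_rob by lia. now rewrite Nat.add_1_r. }
  destruct m as [|m].
  - unfold T. rewrite HX1. symmetry. apply delay_spec; assumption.
  - rewrite <- base_rob by lia. simpl base. destruct Nat.eq_dec as [e|e].
    + exfalso. apply (rob_neq (S k) (S m) ltac:(lia)). exact e.
    + fold (T k). replace (S (k + S m)) with (k + S (S m))%nat by lia.
      now rewrite !base_rob by lia.
Qed.

Lemma path_lt x y t : 0 <= x -> x < y < 2 * PI ->
  path w0 w x (F x) t < path w0 w y (F y) t.
Proof.
  intros Hx Hy. unfold path.
  pose proof (advance_mono N a l1 l2 F HN a_pos Hl1 Hl2 (PRF_0 N l1 l2) F_formula (w * t) x y Hx)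
    as H.
  rewrite N_a in H. specialize (H Hy). lra.
Qed.

(** Initially this is the sorting by [sigma]. Afterwards [path_lt] preserves the order, and the
    robot that just fired leaves 0 at rate [w0 > 0], ahead of the one that resets next. *)
Lemma X_decreasing k m : (m < N)%nat -> X k (S m) < X k m.
Proof.
  revert m. induction k as [|k IH]; intros m Hm.
  - pose proof (Hth _ (rob_lt 0)) as H0. pose proof PI_RGT_0.
    assert (Hbase : forall m', (0 < m' < N)%nat ->
              X 0 m' = th0 (sigma m') + (2 * PI - th0 (rob 0))).
    { intros m' Hm'. rewrite <- base_rob by lia. simpl.
      destruct Nat.eq_dec as [e|e].
      - exfalso. apply (rob_neq 0 m' Hm'). exact e.
      - unfold rob at 1. now rewrite Nat.mod_small by lia. }
    assert (Hrob0 : rob 0 = sigma 0) by (unfold rob; now rewrite Nat.Div0.mod_0_l).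
    destruct (Nat.eq_dec (S m) N) as [e|e].
    + rewrite e, X_N. destruct m as [|m]; [lia|]. rewrite Hbase by lia.
      pose proof (Hth _ (sigma_lt (S m) Hm)). lra.
    + rewrite (Hbase (S m)) by lia. destruct m as [|m].
      * simpl. rewrite Hrob0. pose proof (sigma_decr 0 1 ltac:(lia)). lra.
      * rewrite Hbase by lia. pose proof (sigma_decr (S m) (S (S m)) ltac:(lia)). lra.
  - assert (HX1 : X k 1 < 2 * PI) by (apply (IH 0%nat); lia).
    assert (Hrange : forall m', (0 < m' <= N)%nat -> 0 <= X k m' < 2 * PI).
    { intros m' Hm'. split.
      - destruct (Nat.eq_dec m' N) as [->|]; [rewrite X_N; lra|].
        left. rewrite <- (X_N k). apply (decreasing_steps (X k) N IH); lia.
      - change (2 * PI) with (X k 0). apply (decreasing_steps (X k) N IH); lia. }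
    rewrite (X_succ k m) by assumption.
    destruct (Nat.eq_dec (S m) N) as [e|e].
    + rewrite e, !X_N. unfold path, F. rewrite PRF_0.
      assert (HT : 0 < T k).
      { apply delay_spec; [assumption|assumption|].
        rewrite <- Nat.add_1_r, base_rob by lia. exact HX1. }
      rewrite clamp_0 by nra. nra.
    + rewrite X_succ by (assumption || lia).
      apply path_lt; [apply Hrange; lia|]. split; [apply IH; lia|apply Hrange; lia].
Qed.

Lemma X_lt k m m' : (m < m' <= N)%nat -> X k m' < X k m.
Proof. apply (decreasing_steps (X k) N). apply X_decreasing. Qed.

Lemma X_bounds k m : (0 < m <= N)%nat -> 0 <= X k m < 2 * PI.
Proof.
  intros Hm. split; [|apply (X_lt k 0); lia].
  destruct (Nat.eq_dec m N) as [->|]; [rewrite X_N; lra|].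
  left. rewrite <- (X_N k). apply X_lt. lia.
Qed.

Lemma base_front k : base k (rob (S k)) = X k 1.
Proof. rewrite <- Nat.add_1_r. apply base_rob. lia. Qed.

Lemma T_spec k : 0 < T k /\ path w0 w (X k 1) (F (X k 1)) (T k) = 2 * PI /\
  (forall t, 0 <= t < T k -> path w0 w (X k 1) (F (X k 1)) t < 2 * PI).
Proof. unfold T. rewrite base_front. apply delay_spec; try assumption. apply X_bounds; lia. Qed.

Lemma path_X_anti k m m' t : (0 < m < m')%nat -> (m' <= N)%nat ->
  path w0 w (X k m') (F (X k m')) t < path w0 w (X k m) (F (X k m)) t.
Proof.
  intros Hm Hm'. apply path_lt; [apply X_bounds; lia|].
  split; [apply X_lt; lia|apply X_bounds; lia].
Qed.

Lemma path_below k i t : (i < N)%nat -> 0 <= t < T k ->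
  path w0 w (base k i) (us k i) t < 2 * PI.
Proof.
  intros Hi Ht. destruct (rob_cover k i Hi) as [m [Hm <-]]. unfold us. rewrite base_rob by lia.
  pose proof (proj2 (proj2 (T_spec k)) t Ht).
  destruct (Nat.eq_dec m 1) as [->|]; [assumption|].
  pose proof (path_X_anti k 1 m t ltac:(lia) ltac:(lia)). lra.
Qed.

Lemma path_below_end k i : (i < N)%nat -> i <> rob (S k) ->
  path w0 w (base k i) (us k i) (T k) < 2 * PI.
Proof.
  intros Hi Hne. destruct (rob_cover k i Hi) as [m [Hm <-]]. unfold us. rewrite base_rob by lia.
  rewrite <- (proj1 (proj2 (T_spec k))). apply path_X_anti; [|lia].
  destruct (Nat.eq_dec m 1) as [->|]; [|lia]. rewrite Nat.add_1_r in Hne. contradiction.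
Qed.

Lemma desync : ~ (l1 = 0 /\ l2 = 0) ->
  forall e, 0 < e -> exists K, forall k, (K <= k)%nat -> forall m, (m < N)%nat ->
    Rabs (X k m - X k (S m) - a) <= e.
Proof.
  apply (gaps_converge N a l1 l2 w0 w F X T); try assumption.
  - apply a_pos.
  - apply PRF_0.
  - rewrite N_a. apply PRF_2PI, HN.
  - exact F_formula.
  - intros k. apply T_spec.
  - intros k. now rewrite N_a.
  - exact X_N.
  - exact X_decreasing.
  - intros k m Hm. apply X_succ; [apply X_bounds; lia|exact Hm].
Qed.

(** * The event system runs through the computed pulses *)

Let tr := traj N w0 w l1 l2 th0.
Let ev := ev_time N w0 w l1 l2 th0.

Lemma follows_ext s xs us1 xs' us' t :
  (forall i, (i < N)%nat -> xs i = xs' i /\ us1 i = us' i) ->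
  follows N w0 w s xs us1 t -> follows N w0 w s xs' us' t.
Proof. intros He Hs i Hi. destruct (He i Hi) as [<- <-]. apply Hs, Hi. Qed.

(** No adjustment is active before the first pulse, so the first step is that pulse, fired by the
    robot with the largest initial phase. *)
Lemma first_pulse : 0 < pulse_time 0 /\ next_dt N w0 w (tr 0) = pulse_time 0 /\
  follows N w0 w (tr 1) (base 0) (us 0) 0.
Proof.
  assert (Hp : forall x t, 0 <= t -> path w0 w x 0 t = x + w0 * t).
  { intros x t Ht. unfold path. rewrite clamp_0 by nra. ring. }
  pose proof (Hth _ (rob_lt 0)) as H0.
  assert (Ht0 : w0 * pulse_time 0 = 2 * PI - th0 (rob 0)) by (simpl; field; lra).
  assert (Hpos : 0 < pulse_time 0) by (simpl; apply Rdiv_lt_0_compat; lra).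
  assert (Hmax : forall i, (i < N)%nat -> i <> rob 0 -> th0 i < th0 (rob 0)).
  { intros i Hi Hne. destruct (sigma_onto i Hi) as [m [Hm <-]].
    replace (rob 0) with (sigma 0) in * by (unfold rob; now rewrite Nat.Div0.mod_0_l).
    apply sigma_decr. destruct m; [contradiction|lia]. }
  destruct (step_follows N w0 w l1 l2 Hw0 Hw (tr 0) th0 (fun _ => 0) 0 (rob 0) (pulse_time 0))
    as [Hdt [_ [_ [[_ [_ [i [_ [Hd _]]]]]|[HT Hf]]]]].
  - intros i Hi. rewrite path_0, dir_at_0, rem_at_0, Rabs_R0 by exact Hw.
    unfold tr, sgn, Rdiv. simpl. repeat (destruct Rlt_dec; [lra|]). lra.
  - lra.
  - apply rob_lt.
  - rewrite Hp by lra. lra.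
  - intros i Hi t Ht. rewrite Hp by lra.
    assert (w0 * t < w0 * pulse_time 0) by (apply Rmult_lt_compat_l; lra).
    destruct (Nat.eq_dec i (rob 0)) as [->|Hne]; [lra|]. specialize (Hmax i Hi Hne). lra.
  - intros i Hi Hne. rewrite Hp by lra. specialize (Hmax i Hi Hne). lra.
  - exfalso. apply Hd. unfold dir_at. rewrite Rabs_R0. destruct (Rlt_dec _ _); lra.
  - split; [exact Hpos|]. split; [lra|].
    eapply follows_ext; [|exact Hf]. intros i Hi.
    assert (He : (if Nat.eq_dec i (rob 0) then 0 else path w0 w (th0 i) 0 (pulse_time 0)) = base 0 i).
    { rewrite Hp by lra. rewrite Ht0. reflexivity. }
    unfold us, F. rewrite He. split; reflexivity.
Qed.

Lemma step_between s k t : follows N w0 w s (base k) (us k) t -> 0 <= t < T k ->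
  let dt := next_dt N w0 w s in
  0 < dt /\ t + dt <= T k /\
  (forall i, (i < N)%nat -> forall h, 0 <= h <= dt ->
     ph s i + rate w0 w s i * h = path w0 w (base k i) (us k i) (t + h)) /\
  ((t + dt < T k /\ follows N w0 w (step N w0 w l1 l2 s) (base k) (us k) (t + dt) /\
    exists i, (i < N)%nat /\ dir_at w (us k i) t <> 0 /\ dir_at w (us k i) (t + dt) = 0) \/
   (t + dt = T k /\ follows N w0 w (step N w0 w l1 l2 s) (base (S k)) (us (S k)) 0)).
Proof.
  intros Hs Ht.
  apply (step_follows N w0 w l1 l2 Hw0 Hw s (base k) (us k) t (rob (S k)) (T k)); try assumption.
  - apply rob_lt.
  - unfold us. rewrite base_front. apply T_spec.
  - intros i Hi t' Ht'. apply path_below; assumption.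
  - apply path_below_end.
Qed.

Lemma traj_follows n : exists k t, 0 <= t < T k /\
  follows N w0 w (tr (S n)) (base k) (us k) t /\ ev (S n) = pulse_time k + t.
Proof.
  induction n as [|n [k [t [Ht [Hs He]]]]].
  - destruct first_pulse as [_ [Hdt Hf]]. exists 0%nat, 0.
    split; [split; [lra|apply T_spec]|]. split; [exact Hf|].
    change (ev 1) with (0 + next_dt N w0 w (tr 0)). rewrite Hdt. lra.
  - destruct (step_between _ k t Hs Ht) as [Hdt [_ [_ [[Hlt [Hf _]]|[Heq Hf]]]]].
    + exists k, (t + next_dt N w0 w (tr (S n))). split; [lra|]. split; [exact Hf|].
      change (ev (S (S n))) with (ev (S n) + next_dt N w0 w (tr (S n))). lra.
    + exists (S k), 0. split; [split; [lra|apply T_spec]|]. split; [exact Hf|].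
      change (ev (S (S n))) with (ev (S n) + next_dt N w0 w (tr (S n))).
      simpl pulse_time. lra.
Qed.

Let active (k : nat) (t : R) : nat :=
  length (filter (fun i => if Req_EM_T (dir_at w (us k i) t) 0 then false else true) (seq 0 N)).

(** Induction on the number of active adjustments: a step that is not the pulse ends at least one,
    and none starts before the pulse. *)
Lemma pulse_after n k t : 0 <= t < T k -> follows N w0 w (tr (S n)) (base k) (us k) t ->
  ev (S n) = pulse_time k + t ->
  exists n', follows N w0 w (tr (S n')) (base (S k)) (us (S k)) 0 /\
             ev (S n') = pulse_time (S k).
Proof.
  remember (active k t) as c eqn:Hc. revert n t Hc.
  induction c as [c IH] using lt_wf_ind. intros n t -> Ht Hs He.
  assert (He' : ev (S (S n)) = ev (S n) + next_dt N w0 w (tr (S n))) by reflexivity.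
  destruct (step_between _ k t Hs Ht) as [Hdt [_ [_ [[Hlt [Hf [i [Hi [Hd Hd']]]]]|[Heq Hf]]]]].
  - apply (IH (active k (t + next_dt N w0 w (tr (S n))))) with (n := S n)
      (t := t + next_dt N w0 w (tr (S n))); [|reflexivity|lra|exact Hf|lra].
    apply filter_length_lt.
    + intros x. destruct (Req_EM_T (dir_at w (us k x) (t + _)) 0) as [|Hx]; [discriminate|].
      intros _. destruct (Req_EM_T (dir_at w (us k x) t) 0) as [Hx'|]; [|reflexivity].
      exfalso. pose proof (dir_at_neq w _ _ Hx) as Hab. unfold dir_at in Hx, Hx'.
      destruct (Rlt_dec (w * t) (Rabs (us k x))); [|nra].
      destruct (Rlt_dec _ _); lra.
    + exists i. split; [apply in_seq; lia|].
      destruct (Req_EM_T (dir_at w (us k i) t) 0); [contradiction|].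
      destruct (Req_EM_T (dir_at w (us k i) (t + _)) 0); [tauto|contradiction].
  - exists (S n). split; [exact Hf|]. rewrite He', He. simpl. lra.
Qed.

Lemma pulse_reached k : exists n, follows N w0 w (tr (S n)) (base k) (us k) 0 /\
  ev (S n) = pulse_time k.
Proof.
  induction k as [|k [n [Hs He]]].
  - exists 0%nat. destruct first_pulse as [_ [Hdt Hf]]. split; [exact Hf|].
    change (ev 1) with (0 + next_dt N w0 w (tr 0)). rewrite Hdt. lra.
  - apply (pulse_after n k 0); [split; [lra|apply T_spec]|exact Hs|lra].
Qed.

Lemma pulse_time_mono k k' : (k <= k')%nat -> pulse_time k <= pulse_time k'.
Proof.
  induction 1 as [|k' _ IH]; [lra|]. simpl. pose proof (proj1 (T_spec k')). lra.
Qed.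

(** Eventually the gap in slot 0 is at least [a / 2], and no phase moves faster than [w0 + w]; so
    the time between pulses is bounded below and pulses cannot accumulate. *)
Lemma pulse_time_unbounded : ~ (l1 = 0 /\ l2 = 0) -> forall M, exists k, M < pulse_time k.
Proof.
  intros Hnz M. pose proof a_pos as Ha.
  destruct (desync Hnz (a / 2) ltac:(lra)) as [K HK].
  set (d := a / 2 / (w0 + w)).
  assert (Hd : 0 < d) by (unfold d; apply Rdiv_lt_0_compat; lra).
  assert (HT : forall k, (K <= k)%nat -> d <= T k).
  { intros k Hk. specialize (HK k Hk 0%nat ltac:(lia)).
    destruct (T_spec k) as [Hpos [Hpath _]]. unfold path in Hpath.
    pose proof (clamp_bound (F (X k 1)) (w * T k) ltac:(nra)).
    assert (HX : a / 2 <= 2 * PI - X k 1).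
    { change (X k 0) with (2 * PI) in HK. unfold Rabs in HK. destruct Rcase_abs; lra. }
    apply Rmult_le_reg_l with (w0 + w); [lra|].
    replace ((w0 + w) * d) with (a / 2) by (unfold d; field; lra). lra. }
  assert (Hgrow : forall i, pulse_time K + INR i * d <= pulse_time (K + i)).
  { induction i as [|i IH]; [rewrite Nat.add_0_r; simpl INR; lra|].
    rewrite Nat.add_succ_r, S_INR. specialize (HT (K + i)%nat ltac:(lia)).
    cbn [pulse_time]. lra. }
  destruct (INR_unbounded ((M - pulse_time K) / d)) as [i Hi].
  exists (K + i)%nat. specialize (Hgrow i).
  apply Rmult_lt_compat_r with (r := d) in Hi; [|exact Hd].
  replace ((M - pulse_time K) / d * d) with (M - pulse_time K) in Hi by (field; lra). lra.
Qed.

(** * From phases to headings *)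

(** The robot immediately behind [i] has the next lower initial phase, hence fires next; behind the
    lowest one comes [sigma 0], one turn further, whence the [2 * PI] below. *)
Lemma cyc_next_rob i j : (i < N)%nat -> cyc_next N th0 i j ->
  exists n, i = rob n /\ j = rob (S n).
Proof.
  intros Hi [Hj [Hji Hmin]]. destruct (sigma_onto i Hi) as [m [Hm <-]].
  exists m. assert (Hrm : sigma m = rob m) by (unfold rob; now rewrite Nat.mod_small).
  split; [exact Hrm|].
  destruct (Nat.eq_dec j (rob (S m))) as [|Hne]; [assumption|exfalso].
  specialize (Hmin (rob (S m)) (rob_lt _)).
  rewrite Hrm in Hmin at 1. rewrite <- (Nat.add_1_r m) in Hmin at 1.
  specialize (Hmin (rob_neq m 1 ltac:(lia))).
  destruct (sigma_onto j Hj) as [mj [Hmj <-]].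
  assert (Hmne : mj <> m) by congruence.
  pose proof (Hth _ (sigma_lt m Hm)). pose proof (Hth _ (sigma_lt mj Hmj)).
  assert (Hmod : exists g z, rmod2pi (th0 (sigma m) - th0 (sigma mj)) = g /\
            g = th0 (sigma m) - th0 (sigma mj) + z /\
            ((m < mj)%nat /\ z = 0 \/ (mj < m)%nat /\ z = 2 * PI)).
  { destruct (Nat.lt_trichotomy m mj) as [H'|[H'|H']]; [|congruence|].
    - pose proof (sigma_decr m mj ltac:(lia)).
      exists (th0 (sigma m) - th0 (sigma mj)), 0. split; [|split; [lra|left; auto]].
      apply rmod2pi_unique with 0%Z; [lra|ring].
    - pose proof (sigma_decr mj m ltac:(lia)).
      exists (th0 (sigma m) - th0 (sigma mj) + 2 * PI), (2 * PI).
      split; [|split; [lra|right; auto]].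
      apply rmod2pi_unique with (-1)%Z; [lra|ring]. }
  destruct Hmod as [g [z [Hg [Hz Hcase]]]]. rewrite Hg in Hmin.
  destruct (Nat.eq_dec (S m) N) as [e|e].
  - assert (Hs : rob (S m) = sigma 0) by (unfold rob; rewrite e, Nat.Div0.mod_same; reflexivity).
    rewrite Hs in *. pose proof (sigma_decr 0 m ltac:(lia)).
    pose proof (Hth _ (sigma_lt 0 ltac:(lia))).
    rewrite (rmod2pi_unique _ (th0 (sigma m) - th0 (sigma 0%nat) + 2 * PI) (-1)%Z) in Hmin
      by (lra || ring).
    assert (mj <> 0)%nat by congruence.
    pose proof (sigma_decr 0 mj ltac:(lia)).
    destruct Hcase as [[? ->]|[? ->]]; [lia|lra].
  - assert (Hs : rob (S m) = sigma (S m)) by (unfold rob; rewrite Nat.mod_small by lia; reflexivity).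
    rewrite Hs in *. pose proof (sigma_decr m (S m) ltac:(lia)).
    pose proof (Hth _ (sigma_lt (S m) ltac:(lia))).
    rewrite (rmod2pi_unique _ (th0 (sigma m) - th0 (sigma (S m))) 0%Z) in Hmin by (lra || ring).
    assert (mj <> S m) by congruence.
    destruct Hcase as [[? ->]|[? ->]]; [|lra].
    pose proof (sigma_decr (S m) mj ltac:(lia)). lra.
Qed.

Let travel (k m : nat) (t : R) : R := path w0 w (X k m) (F (X k m)) t.

(** The change of the gap since the pulse is a difference of truncated pushes, bounded by its value
    at [T k] ([clamp_diff_mono]). That value is a gap of pulse [S k] minus one of pulse [k], so at
    most [2 * e]. *)
Lemma travel_gap k m t e : (m < N)%nat -> 0 <= t <= T k ->
  (forall m', (m' < N)%nat -> Rabs (X k m' - X k (S m') - a) <= e) ->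
  (forall m', (m' < N)%nat -> Rabs (X (S k) m' - X (S k) (S m') - a) <= e) ->
  Rabs (travel k m t - travel k (S m) t - a) <= 3 * e.
Proof.
  intros Hm Ht H0 H1.
  assert (Hend : exists m', (m' < N)%nat /\
            travel k m (T k) - travel k (S m) (T k) = X (S k) m' - X (S k) (S m')).
  { pose proof (T_spec k) as [HTp [HT1 _]].
    assert (Hs : forall m', (m' < N)%nat -> travel k (S m') (T k) = X (S k) m').
    { intros m' Hm'. symmetry. apply X_succ; [apply X_bounds; lia|exact Hm']. }
    rewrite Hs by exact Hm. destruct m as [|m].
    - exists (N - 1)%nat. split; [lia|]. replace (S (N - 1)) with N by lia.
      rewrite X_N, <- (Hs (N - 1)%nat) by lia. replace (S (N - 1)) with N by lia.
      unfold travel, path. rewrite X_N. change (X k 0) with (2 * PI). change (X (S k) 0) with (2 * PI).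
      unfold F. rewrite PRF_0, PRF_2PI, clamp_0 by (exact HN || nra). ring.
    - exists m. split; [lia|]. now rewrite Hs by lia. }
  destruct Hend as [m' [Hm' Hend]]. unfold travel, path in *.
  specialize (H0 m Hm). specialize (H1 m' Hm').
  pose proof (clamp_diff_mono (F (X k m)) (F (X k (S m))) (w * t) (w * T k)
    ltac:(split; [nra|apply Rmult_le_compat_l; lra])) as Hc.
  revert H0 H1 Hc. rewrite <- Hend. unfold Rabs. repeat destruct Rcase_abs; lra.
Qed.

Lemma traj_headings n k t s m : 0 <= t < T k ->
  follows N w0 w (tr (S n)) (base k) (us k) t -> 0 <= s < next_dt N w0 w (tr (S n)) ->
  (m < N)%nat ->
  let g := travel k m (t + s) - travel k (S m) (t + s) in
  0 <= g < 2 * PI ->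
  rmod2pi (heading N w0 w l1 l2 th0 (S n) s (rob (k + m))
           - heading N w0 w l1 l2 th0 (S n) s (rob (k + S m))) = g.
Proof.
  intros Ht Hs Hs' Hm g Hg. destruct (step_between _ k t Hs Ht) as [_ [HT [Hflow _]]].
  unfold heading. fold tr.
  rewrite !Hflow by (apply rob_lt || lra).
  unfold us at 2. rewrite (base_rob k (S m)) by lia.
  destruct m as [|m].
  (* The fired robot has phase 0 in the state, while [travel] starts it at [2 * PI]; hence the full
     turn. *)
  - apply rmod2pi_sub with (-1)%Z; [exact Hg|]. rewrite Nat.add_0_r. unfold us.
    rewrite base_fired. unfold g, travel, path. change (X k 0) with (2 * PI).
    unfold F. rewrite PRF_0, PRF_2PI by exact HN. ring.
  - apply rmod2pi_sub with 0%Z; [exact Hg|]. unfold us.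
    rewrite base_rob by lia. unfold g, travel. ring.
Qed.

Lemma event_times_unbounded : ~ (l1 = 0 /\ l2 = 0) -> forall M, exists n, M < ev n.
Proof.
  intros Hnz M. destruct (pulse_time_unbounded Hnz M) as [k Hk].
  destruct (pulse_reached k) as [n [_ Hn]]. exists (S n). rewrite Hn. exact Hk.
Qed.

Lemma rate_bounded n i : (i < N)%nat -> Rabs (rate w0 w (tr n) i - w0) <= w.
Proof.
  intros Hi. unfold rate. replace (w0 + dir (tr n) i * w - w0) with (dir (tr n) i * w) by ring.
  destruct n as [|n].
  - simpl. rewrite Rmult_0_l, Rabs_R0. lra.
  - destruct (traj_follows n) as [k [t [_ [Hf _]]]]. destruct (Hf i Hi) as [_ [-> _]].
    apply dir_at_abs, Hw.
Qed.

Lemma headings_desynchronize i j : ~ (l1 = 0 /\ l2 = 0) -> (i < N)%nat ->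
  cyc_next N th0 i j -> forall eps, 0 < eps -> exists M, forall n s,
    0 <= s < next_dt N w0 w (tr n) -> M <= ev n + s ->
    Rabs (rmod2pi (heading N w0 w l1 l2 th0 n s i - heading N w0 w l1 l2 th0 n s j) - a) < eps.
Proof.
  intros Hnz Hi Hij eps Heps.
  destruct (cyc_next_rob i j Hi Hij) as [q [-> ->]].
  pose proof a_pos as Ha. pose proof (two_a_le N a HN Ha) as H2a. rewrite N_a in H2a.
  (* [3 * e] is the loss in [travel_gap]. It must stay below [eps], and at most [a / 2] so that the
     gap lies in [[0, 2 * PI)] and is its own remainder. *)
  set (e := Rmin (eps / 2) (a / 2) / 3).
  assert (He : 0 < e /\ 3 * e <= eps / 2 /\ 3 * e <= a / 2).
  { assert (0 < Rmin (eps / 2) (a / 2)) by (apply Rmin_glb_lt; lra).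
    pose proof (Rmin_l (eps / 2) (a / 2)). pose proof (Rmin_r (eps / 2) (a / 2)).
    unfold e. lra. }
  destruct (desync Hnz e ltac:(lra)) as [K HK].
  exists (pulse_time K). intros [|n] s Hs HM.
  (* State 0 ends at the first pulse, before the threshold time. *)
  { destruct first_pulse as [_ [Hdt _]]. rewrite Hdt in Hs.
    change (ev 0) with 0 in HM. pose proof (pulse_time_mono 0 K ltac:(lia)). lra. }
  destruct (traj_follows n) as [k [t [Ht [Hf Hev]]]].
  destruct (step_between _ k t Hf Ht) as [_ [Hle _]].
  assert (Hk : (K <= k)%nat).
  { apply Nat.nlt_ge. intros Hc. pose proof (pulse_time_mono (S k) K Hc) as Hmono.
    rewrite Hev in HM. simpl in Hmono. lra. }
  set (m := slot N q k).
  assert (Hm : (m < N)%nat) by (apply slot_lt; exact HN).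
  assert (Hq : rob q = rob (k + m) /\ rob (S q) = rob (k + S m)).
  { unfold rob. pose proof (slot_congr N HN q k) as Hc. fold m in Hc.
    split; [now rewrite Hc|].
    rewrite Nat.add_succ_r, <- (Nat.add_1_r q), <- (Nat.add_1_r (k + m)).
    now rewrite (Nat.Div0.add_mod q), (Nat.Div0.add_mod (k + m)), Hc. }
  destruct Hq as [-> ->].
  pose proof (travel_gap k m (t + s) e Hm ltac:(lra) (HK k Hk) (HK (S k) ltac:(lia))) as Hgap.
  rewrite (traj_headings n k t s m Ht Hf Hs Hm).
  - eapply Rle_lt_trans; [exact Hgap|lra].
  - revert Hgap. unfold Rabs. destruct Rcase_abs; lra.
Qed.

End Trajectory.

Theorem theorem3 (N : nat) (w0 wmax l1 l2 : R) (th0 : nat -> R) :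
  (2 <= N)%nat ->
  0 < w0 -> 0 < wmax ->
  0 <= l1 < 1 -> 0 <= l2 < 1 -> ~ (l1 = 0 /\ l2 = 0) ->
  (forall i, (i < N)%nat -> 0 <= th0 i < 2 * PI) ->
  (forall i j, (i < N)%nat -> (j < N)%nat -> i <> j -> th0 i <> th0 j) ->
  (* the trajectory is defined for all times (event times are unbounded) *)
  (forall M, exists k, M < ev_time N w0 wmax l1 l2 th0 k) /\
  (* rate constraint: |d theta_i / dt| = |omega_i - w0| <= wmax at all times *)
  (forall k i, (i < N)%nat ->
     Rabs (rate w0 wmax (traj N w0 wmax l1 l2 th0 k) i - w0) <= wmax) /\
  (* desynchronization: cyclically consecutive heading differences -> 2 PI / N *)
  (forall i j, (i < N)%nat -> cyc_next N th0 i j ->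
     forall eps, 0 < eps -> exists T, forall k s,
       0 <= s < next_dt N w0 wmax (traj N w0 wmax l1 l2 th0 k) ->
       T <= ev_time N w0 wmax l1 l2 th0 k + s ->
       Rabs (rmod2pi (heading N w0 wmax l1 l2 th0 k s i
                      - heading N w0 wmax l1 l2 th0 k s j) - 2 * PI / INR N) < eps).
Proof.
  intros HN Hw0 Hw Hl1 Hl2 Hnz Hth Hdist.
  destruct (exists_decreasing_order N th0 Hdist) as [sigma [Hlt [Honto Hdecr]]].
  split; [|split].
  - now apply event_times_unbounded with sigma.
  - intros k i Hi. now apply rate_bounded with sigma.
  - intros i j Hi Hij. now apply headings_desynchronize with sigma.
Qed.
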